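(* Fix $b_1,b_2\in\mathbb{R}$ and, for $a_0,b_0\in\mathbb{R}$ with $b_0+b_2>0$, let $A(t)=a_0-\sin t-a_0\cos t$, $B(t)=b_0+b_1\sin t+b_2\cos t$, and consider the Abel equation $x'=A(t)x^3+B(t)x^2$ on $[0,2\pi]$. Assume there exists $\epsilon>0$ such that for every $a_0,b_0$ with $-\epsilon<b_0<0<a_0<\epsilon$ the following hold: $(C_1)$ $A(0)=0$; $A$ has exactly one zero $t_A$ in $(0,2\pi)$, and it is simple; $B$ has exactly two zeros $t_{B_1},t_{B_2}$ in $[0,2\pi]$, both simple; and $0<t_{B_1}<t_A<t_{B_2}\le2\pi$; and for any singular positive closed solution $\tilde u(t)$ of the equation: $(C_2)$ the function $2A(t)\tilde u(t)+B(t)$ has at most one zero, simple if it exists, in each of the intervals $[0,t_A]$ and $[t_A,2\pi]$; $(C_3)$ $\operatorname{sgn}(v(t,\tilde u(t)))=\operatorname{sgn}(A'(0)B(0))$ for all $t\in[0,2\pi]$. Then the equation has at most two positive closed solutions for every $a_0,b_0$ with $-\epsilon<b_0<0<a_0<\epsilon$.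
   Context: The standing assumption is $b_0+b_2>0$ for all parameter values considered (so $B(0)>0$, and $A'(0)=-1<0$). Let $u(t,x)$ be the solution with $u(0,x)=x$. It is closed if it is defined on $[0,2\pi]$ and $u(2\pi,x)=x$, positive if $x>0$; a closed solution $u(t,\tilde x)$ is singular if $u_x(2\pi,\tilde x)=1$. Here $P(t)=4(B(t)A'(t)-B'(t)A(t))-B(t)^3$ and $v(t,x)=B(t)(2A(t)x+B(t))^2+P(t)$. *)

(* Defs.v *)
From Stdlib Require Export Reals.
From Coquelicot Require Export Coquelicot.

Open Scope R_scope.

Definition coefA (a0 t : R) : R := a0 - sin t - a0 * cos t.

Definition coefB (b0 b1 b2 t : R) : R := b0 + b1 * sin t + b2 * cos t.

Definition period (t : R) : Prop := 0 <= t <= 2 * PI.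

(* [D_in f d D t]: the derivative at [t] of [f] restricted to [D] is [d t].
   It is one-sided at the endpoints of [period], and the values of [u] outside
   [period] are irrelevant. *)
Definition abel_solution (A B u : R -> R) : Prop :=
  forall t, period t ->
    D_in u (fun s => A s * u s ^ 3 + B s * u s ^ 2) period t.

Definition closed_solution (A B u : R -> R) : Prop :=
  abel_solution A B u /\ u (2 * PI) = u 0.

Definition positive_closed_solution (A B u : R -> R) : Prop :=
  closed_solution A B u /\ 0 < u 0.

(* [U t x] is the solution u(t,x) with u(0,x) = x, for all initial values [x]
   in a neighbourhood of [x0]; by uniqueness it is determined there. *)
Definition local_flow (A B : R -> R) (x0 : R) (U : R -> R -> R) : Prop :=
  locally x0 (fun x => abel_solution A B (fun t => U t x) /\ U 0 x = x).

Definition singular_positive_closed_solution (A B u : R -> R) : Prop :=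
  positive_closed_solution A B u /\
  exists U : R -> R -> R,
    local_flow A B (u 0) U /\ is_derive (fun x => U (2 * PI) x) (u 0) 1.

(* The derivative is taken relative to [period] because [f] may involve a
   solution, which is only meaningful there. *)
Definition simple_zero (f : R -> R) (t : R) : Prop :=
  f t = 0 /\ exists d : R, d <> 0 /\ D_in f (fun _ => d) period t.

Definition condC1 (A B : R -> R) (tA tB1 tB2 : R) : Prop :=
  A 0 = 0 /\
  (forall t, 0 < t < 2 * PI -> (A t = 0 <-> t = tA)) /\
  simple_zero A tA /\
  (forall t, period t -> (B t = 0 <-> t = tB1 \/ t = tB2)) /\
  simple_zero B tB1 /\ simple_zero B tB2 /\
  0 < tB1 /\ tB1 < tA /\ tA < tB2 /\ tB2 <= 2 * PI.

Definition at_most_one_zero_simple (f : R -> R) (a b : R) : Prop :=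
  (forall s t, a <= s <= b -> a <= t <= b -> f s = 0 -> f t = 0 -> s = t) /\
  (forall t, a <= t <= b -> f t = 0 -> simple_zero f t).

Definition condC2 (A B : R -> R) (tA : R) (u : R -> R) : Prop :=
  at_most_one_zero_simple (fun t => 2 * A t * u t + B t) 0 tA /\
  at_most_one_zero_simple (fun t => 2 * A t * u t + B t) tA (2 * PI).

Definition funP (A B : R -> R) (t : R) : R :=
  4 * (B t * Derive A t - Derive B t * A t) - B t ^ 3.

Definition funv (A B : R -> R) (t x : R) : R :=
  B t * (2 * A t * x + B t) ^ 2 + funP A B t.

Definition condC3 (A B u : R -> R) : Prop :=
  forall t, period t -> sign (funv A B t (u t)) = sign (Derive A 0 * B 0).

Definition conditions (A B : R -> R) : Prop :=
  exists tA tB1 tB2 : R,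
    condC1 A B tA tB1 tB2 /\
    forall u : R -> R, singular_positive_closed_solution A B u ->
      condC2 A B tA u /\ condC3 A B u.

Definition same_solution (u v : R -> R) : Prop :=
  forall t, period t -> u t = v t.

Definition at_most_two_positive_closed_solutions (A B : R -> R) : Prop :=
  forall u1 u2 u3 : R -> R,
    positive_closed_solution A B u1 ->
    positive_closed_solution A B u2 ->
    positive_closed_solution A B u3 ->
    same_solution u1 u2 \/ same_solution u1 u3 \/ same_solution u2 u3.

(* Main.v *)
Require Import Defs.
From Stdlib Require Import Lra Lia Psatz Classical IndefiniteDescription.

(** Write D(x) = u(2 pi, x) - x for the displacement of the solution with
    initial value x > 0.  Positive closed solutions are the zeros of D.  Since
    A and B increase with a0 and b0 (their derivatives are 1 - cos t and 1),
    D(x) is strictly increasing in a0 and in b0; a solution that blows up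
    before 2 pi counts as having a positive displacement.

    The local fact.  Let u be closed and G(t) the integral of A u^2 over
    [0, t].  The derivative of the return map is u_x = (u / x)^2 e^G, so u is
    singular exactly when G(2 pi) = 0, and then the second derivative of the
    return map has the sign of the integral of A u^3 e^G.  The sign of v in
    (C3) says precisely that B / (A u) is increasing on each of (0, tA) and
    (tA, 2 pi), because its derivative is - v / (4 A^2 u).  Choose kappa so
    that x e^(kappa G) agrees with u at 0, tA and 2 pi.  The derivative of
    ln u - kappa G is A u^2 (B / (A u) + 1 - kappa), so this function stays
    above its common end value on [0, tA] and below it on [tA, 2 pi]
    (singular_comparison).  A function of G times A u^2 has integral zero, as G
    returns to 0; comparing u with x e^(kappa G) therefore gives a strict sign
    to the integrals of A u^2 f(u, G) with f increasing in u.  With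
    f = u e^G the displacement has a strict local maximum at every singular
    solution (singular_curvature_neg).  With f = - 1 / u one gets b0 < 0
    (singular_b_neg); that argument only needs v <= 0, a closed condition, so
    singular solutions cannot accumulate at b0 = 0.

    The global argument.  Suppose D vanishes at x1 < x2 < x3 for some (a0, b0).
    First, D > 0 on all of (0, x3] for (a0, 0) (b_zero_no_return).  Otherwise,
    for every slightly negative b, D is negative at some fixed x' < x3 but not
    at x3.  When a0 is lowered to 0 all displacements become negative, by the
    reflection t -> 2 pi - t.  The last value of a0 for which D <= 0 on
    [x', X] carries a zero of D at a local maximum.  It cannot sit at the end X
    if X is large, because B(0) > 0 makes large closed solutions contracting;
    so it is a singular solution with b arbitrarily close to 0, which is
    excluded.  Second, raise b0 towards 0 until D >= 0 on [x1, x3]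
    (no_three_closed): this happens at some b < 0, and then D has an interior
    zero at a local minimum.  Such a zero is singular, hence a strict local
    maximum, a contradiction.

    Compactness of these arguments rests on the bound u(t) sin(t/2) <= N, with
    N independent of the initial value (sol_sin_half_bound).  It makes closed
    solutions with bounded ends uniformly bounded, so that D <= 0 is a closed
    condition. *)

(** * Calculus on an interval and linear equations *)

(** Unlike repeat split, this does not open definitions. *)
Ltac splits := repeat match goal with |- _ /\ _ => split end.

Lemma derive_mono (f df : R -> R) (a b : R) :
  a <= b ->
  (forall t, a <= t <= b -> is_derive f t (df t)) ->
  (forall t, a < t < b -> 0 <= df t) ->
  f a <= f b.
Proof.
  intros hab hf hdf.
  destruct (Req_dec a b) as [-> | hne]; [lra | ].
  destruct (MVT_cor2 f df a b) as [c [hc hc']]; [lra | | ].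
  - intros c hc. apply is_derive_Reals, hf, hc.
  - specialize (hdf c hc'). nra.
Qed.

Lemma derive_mono_strict (f df : R -> R) (a b : R) :
  a < b ->
  (forall t, a <= t <= b -> is_derive f t (df t)) ->
  (forall t, a < t < b -> 0 < df t) ->
  f a < f b.
Proof.
  intros hab hf hdf.
  destruct (MVT_cor2 f df a b) as [c [hc hc']]; [lra | | ].
  - intros c hc. apply is_derive_Reals, hf, hc.
  - specialize (hdf c hc'). nra.
Qed.

Lemma derive_bound (f df : R -> R) (a b C : R) :
  a <= b ->
  (forall t, a <= t <= b -> is_derive f t (df t)) ->
  (forall t, a < t < b -> Rabs (df t) <= C) ->
  Rabs (f b - f a) <= C * (b - a).
Proof.
  intros hab hf hdf.
  destruct (Req_dec a b) as [-> | hne].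
  - rewrite Rminus_diag, Rabs_R0. lra.
  - destruct (MVT_cor2 f df a b) as [c [hc hc']]; [lra | | ].
    + intros c hc. apply is_derive_Reals, hf, hc.
    + rewrite hc, Rabs_mult, (Rabs_pos_eq (b - a)) by lra.
      apply Rmult_le_compat_r; [lra | auto].
Qed.

(** Replaces the terms Derive f t that auto_derive leaves for unknown functions
    by the values given in the hypotheses. *)
Ltac derive_rewrite :=
  repeat match goal with
  | h : is_derive ?f ?t ?l |- context [Derive ?g ?t] =>
      replace (Derive g t) with l by (symmetry; apply is_derive_unique; exact h)
  end.
Ltac derive_by_hyps :=
  auto_derive; [repeat split; try (eexists; eassumption) | derive_rewrite].

Lemma derive_RInt_plus (f : R -> R) (x : R) :
  (forall t, continuous f t) -> forall t, is_derive (fun t => x + RInt f 0 t) t (f t).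
Proof.
  intros hf t.
  assert (h : is_derive (fun t => RInt f 0 t) t (f t)).
  { apply (is_derive_RInt f (fun t => RInt f 0 t) 0 t); [ | apply hf].
    apply filter_forall. intros z.
    apply (RInt_correct (V := R_CompleteNormedModule)).
    apply (ex_RInt_continuous (V := R_CompleteNormedModule)).
    intros; apply hf. }
  evar_last.
  - apply (is_derive_plus (fun _ => x)); [apply is_derive_const | exact h].
  - apply (plus_zero_l (G := R_AbelianMonoid)).
Qed.

Lemma primitive (f : R -> R) :
  (forall t, continuous f t) ->
  exists F : R -> R, F 0 = 0 /\ forall t, is_derive F t (f t).
Proof.
  intros hf. exists (fun t => 0 + RInt f 0 t). split.
  - rewrite (RInt_point (V := R_CompleteNormedModule)). apply Rplus_0_l.
  - apply derive_RInt_plus, hf.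
Qed.

(** Linear equations e' = k e + r are handled throughout by multiplying with
    such an m, which turns them into (e m)' = r m. *)
Lemma integrating_factor (k : R -> R) :
  (forall t, continuous k t) ->
  exists m : R -> R,
    (forall t, 0 < m t) /\ forall t, is_derive m t (- k t * m t).
Proof.
  intros hk. destruct (primitive k hk) as [K [_ hK]].
  exists (fun t => exp (- K t)). split.
  - intros t. apply exp_pos.
  - intros t. specialize (hK t).
    derive_by_hyps. ring.
Qed.

(** The positive constant m only matters through its sign: the lemma transports
    the sign of e from a to b. *)
Lemma linear_nonpos (k e r : R -> R) (a b : R) :
  a <= b -> (forall t, continuous k t) ->
  (forall t, a <= t <= b -> is_derive e t (k t * e t + r t)) ->
  (forall t, a < t < b -> r t <= 0) ->
  exists m, 0 < m /\ e b <= m * e a.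
Proof.
  intros hab hk he hr.
  destruct (integrating_factor k hk) as [m [hm hm']].
  assert (h : - (e a * m a) <= - (e b * m b)).
  { apply (derive_mono (fun t => - (e t * m t)) (fun t => - (r t * m t))); auto.
    - intros t ht. specialize (he t ht). specialize (hm' t).
      derive_by_hyps. ring.
    - intros t ht. specialize (hr t ht). specialize (hm t). nra. }
  exists (m a / m b). split.
  - apply Rdiv_lt_0_compat; auto.
  - apply (Rmult_le_reg_r (m b)); auto.
    replace (m a / m b * e a * m b) with (e a * m a)
      by (field; apply Rgt_not_eq, hm). lra.
Qed.

Lemma linear_neg (k e r : R -> R) (a b : R) :
  a < b -> (forall t, continuous k t) ->
  (forall t, a <= t <= b -> is_derive e t (k t * e t + r t)) ->
  (forall t, a < t < b -> r t < 0) ->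
  exists m, 0 < m /\ e b < m * e a.
Proof.
  intros hab hk he hr.
  destruct (integrating_factor k hk) as [m [hm hm']].
  assert (h : - (e a * m a) < - (e b * m b)).
  { apply (derive_mono_strict (fun t => - (e t * m t)) (fun t => - (r t * m t))); auto.
    - intros t ht. specialize (he t ht). specialize (hm' t).
      derive_by_hyps. ring.
    - intros t ht. specialize (hr t ht). specialize (hm t). nra. }
  exists (m a / m b). split.
  - apply Rdiv_lt_0_compat; auto.
  - apply (Rmult_lt_reg_r (m b)); auto.
    replace (m a / m b * e a * m b) with (e a * m a)
      by (field; apply Rgt_not_eq, hm). lra.
Qed.

Lemma linear_homogeneous (k e : R -> R) (a b : R) :
  a <= b -> (forall t, continuous k t) ->
  (forall t, a <= t <= b -> is_derive e t (k t * e t)) ->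
  exists m, 0 < m /\ e b = m * e a.
Proof.
  intros hab hk he.
  destruct (integrating_factor k hk) as [m [hm hm']].
  assert (h : Rabs (e b * m b - e a * m a) <= 0 * (b - a)).
  { apply (derive_bound (fun t => e t * m t) (fun t => 0)); auto.
    - intros t ht. specialize (he t ht). specialize (hm' t).
      derive_by_hyps. ring.
    - intros t ht. rewrite Rabs_R0. lra. }
  exists (m a / m b). split.
  - apply Rdiv_lt_0_compat; auto.
  - apply (Rmult_eq_reg_r (m b)); [ | apply Rgt_not_eq, hm].
    replace (m a / m b * e a * m b) with (e a * m a)
      by (field; apply Rgt_not_eq, hm).
    revert h. unfold Rabs; destruct Rcase_abs; lra.
Qed.

Lemma continuous_of_eps (f : R -> R) (x : R) :
  (forall eps, 0 < eps ->
     exists d, 0 < d /\ forall y, Rabs (y - x) < d -> Rabs (f y - f x) < eps) ->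
  continuous f x.
Proof.
  intros h. apply continuity_pt_filterlim.
  intros eps heps. destruct (h eps heps) as [d [hd hd']].
  exists d. split; [exact hd | ]. intros y [_ hy]. apply hd', hy.
Qed.

Lemma eps_of_continuous (f : R -> R) (x : R) :
  continuous f x ->
  forall eps, 0 < eps ->
     exists d, 0 < d /\ forall y, Rabs (y - x) < d -> Rabs (f y - f x) < eps.
Proof.
  intros h eps heps.
  apply continuity_pt_filterlim in h.
  destruct (h eps heps) as [d [hd hd']].
  exists d. split; [exact hd | ]. intros y hy.
  destruct (Req_dec x y) as [<- | hne].
  - rewrite Rminus_diag, Rabs_R0. exact heps.
  - apply hd'. repeat split; auto.
Qed.

(** Lebesgue number argument: a property Q x d that weakens as d shrinks and
    holds locally uniformly in x holds with one d on a compact interval. *)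
Lemma compact_uniform (Q : R -> R -> Prop) (lo hi : R) :
  (forall x d d', 0 < d' <= d -> Q x d -> Q x d') ->
  (forall x, lo <= x <= hi -> exists d, 0 < d /\
     forall y, lo <= y <= hi -> Rabs (y - x) < d -> Q y d) ->
  exists d, 0 < d /\ forall x, lo <= x <= hi -> Q x d.
Proof.
  intros hmono hloc.
  assert (hch : forall x, exists d : posreal, lo <= x <= hi ->
     forall y, lo <= y <= hi -> Rabs (y - x) < d -> Q y d).
  { intros x. destruct (classic (lo <= x <= hi)) as [hx | hx].
    - destruct (hloc x hx) as [d [hd hd']]. exists (mkposreal d hd). auto.
    - exists (mkposreal 1 Rlt_0_1). tauto. }
  apply functional_choice in hch. destruct hch as [delta hdelta].
  destruct (compactness_value_1d lo hi delta) as [d hd].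
  exists d. split; [apply cond_pos | ].
  intros x hx. apply NNPP. intros hn.
  apply (hd x hx). intros [t [ht [hxt hdt]]]. apply hn.
  apply (hmono x (delta t)); [split; [apply cond_pos | exact hdt] | ].
  apply (hdelta t ht); auto.
Qed.

(** * Existence of solutions for globally Lipschitz fields *)

Fixpoint picard_iterate (F : R -> R -> R) (x : R) (n : nat) (t : R) : R :=
  match n with
  | O => x
  | S n => x + RInt (fun s => F s (picard_iterate F x n s)) 0 t
  end.

Lemma derive_continuous (f : R -> R) (t l : R) : is_derive f t l -> continuous f t.
Proof.
  intros h. apply (ex_derive_continuous (V := R_NormedModule)). exists l; exact h.
Qed.

Lemma RInt_0_0 (f : R -> R) : RInt f 0 0 = 0.
Proof. apply (RInt_point (V := R_CompleteNormedModule)). Qed.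

Lemma lim_seq_abs_le (u : nat -> R) (l c : R) :
  is_lim_seq u l -> (forall n, Rabs (u n) <= c) -> Rabs l <= c.
Proof.
  intros hu hc.
  change (Rbar_le (Rabs l) c).
  apply (is_lim_seq_le (fun n => Rabs (u n)) (fun _ => c)); auto.
  - apply (is_lim_seq_abs _ (Finite l)), hu.
  - apply is_lim_seq_const.
Qed.

(** The iterates contract in the weighted norm sup |phi(t)| exp(- 2 K t), which
    gives convergence on the whole half line at once; the limit inherits the
    Lipschitz constant L of the iterates. *)
Lemma picard (F : R -> R -> R) (K L x : R) :
  0 < K ->
  (forall phi, (forall t, continuous phi t) ->
     forall t, continuous (fun s => F s (phi s)) t) ->
  (forall t y, Rabs (F t y) <= L) ->
  (forall t y z, Rabs (F t y - F t z) <= K * Rabs (y - z)) ->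
  exists phi : R -> R, phi 0 = x /\ (forall t, continuous phi t) /\
    forall t, 0 <= t -> is_derive phi t (F t (phi t)).
Proof.
  intros hK hcont hL hlip.
  set (p := picard_iterate F x).
  assert (pcont : forall n t, continuous (p n) t).
  { induction n as [ | n IH]; intros t.
    - apply continuous_const.
    - eapply derive_continuous.
      apply (derive_RInt_plus (fun s => F s (p n s))). apply hcont, IH. }
  assert (pder : forall n t, is_derive (p (S n)) t (F t (p n t))).
  { intros n t. apply (derive_RInt_plus (fun s => F s (p n s))). apply hcont, pcont. }
  assert (p0 : forall n, p n 0 = x).
  { destruct n as [ | n]; [reflexivity | ]. unfold p; simpl. rewrite RInt_0_0. ring. }
  assert (hL0 : 0 <= L) by (eapply Rle_trans; [apply Rabs_pos | apply (hL 0 0)]).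
  set (C := L / K).
  assert (hCK : K * C = L) by (unfold C; field; lra).
  assert (hC : 0 <= C) by (unfold C; apply Rdiv_le_0_compat; lra).
  assert (hstep : forall n t, 0 <= t ->
     Rabs (p (S n) t - p n t) <= C * (1 / 2) ^ n * exp (2 * K * t)).
  { induction n as [ | n IH]; intros t ht.
    - assert (h : Rabs (p 1%nat t - p 1%nat 0) <= L * (t - 0)).
      { apply (derive_bound (p 1%nat) (fun t => F t (p O t))); auto. }
      rewrite (p0 1%nat) in h. change (p O t) with x. simpl.
      assert (he := exp_ineq1_le (2 * K * t)).
      apply Rle_trans with (1 := h). rewrite Rmult_1_r, Rminus_0_r.
      apply Rle_trans with (C * (K * t)); [nra | ].
      apply Rmult_le_compat_l; [exact hC | nra].
    - set (q := (1 / 2) ^ n) in *.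
      assert (hq : 0 < q) by (apply pow_lt; lra).
      assert (hdiff : forall s, 0 <= s ->
        Rabs (F s (p (S n) s) - F s (p n s)) <= L * q * exp (2 * K * s)).
      { intros s hs. eapply Rle_trans; [apply hlip | ].
        rewrite <- hCK.
        apply Rle_trans with (K * (C * q * exp (2 * K * s))); [ | right; ring].
        apply Rmult_le_compat_l; [lra | apply IH, hs]. }
      assert (hd1 : forall s, is_derive (p (S (S n))) s (F s (p (S n) s))) by apply pder.
      assert (hd2 : forall s, is_derive (p (S n)) s (F s (p n s))) by apply pder.
      assert (hexp : forall s, is_derive (fun s => C * (q / 2) * exp (2 * K * s)) s
                 (L * q * exp (2 * K * s))).
      { intros s. auto_derive; [auto | ]. rewrite <- hCK. field. }
      assert (h0 := p0 (S n)). assert (h0' := p0 (S (S n))).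
      replace ((1 / 2) ^ S n) with (q / 2) by (unfold q; simpl; field).
      assert (hpos : 0 <= C * (q / 2) * exp (2 * K * 0)).
      { rewrite Rmult_0_r, exp_0. nra. }
      apply Rabs_le. split.
      + assert (h := derive_mono
          (fun s => C * (q / 2) * exp (2 * K * s) + (p (S (S n)) s - p (S n) s))
          (fun s => L * q * exp (2 * K * s) + (F s (p (S n) s) - F s (p n s))) 0 t ht).
        cbv beta in h. cut (0 <= C * (q / 2) * exp (2 * K * t) + (p (S (S n)) t - p (S n) t)); [lra | ].
        eapply Rle_trans; [ | apply h]; [lra | | ].
        * intros s hs. apply (is_derive_plus (V := R_NormedModule)); [apply hexp | ].
          apply (is_derive_minus (V := R_NormedModule)); auto.
        * intros s hs. assert (hb := hdiff s ltac:(lra)).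
          apply Rabs_le_between in hb. lra.
      + assert (h := derive_mono
          (fun s => C * (q / 2) * exp (2 * K * s) - (p (S (S n)) s - p (S n) s))
          (fun s => L * q * exp (2 * K * s) - (F s (p (S n) s) - F s (p n s))) 0 t ht).
        cbv beta in h. cut (0 <= C * (q / 2) * exp (2 * K * t) - (p (S (S n)) t - p (S n) t)); [lra | ].
        eapply Rle_trans; [ | apply h]; [lra | | ].
        * intros s hs. apply (is_derive_minus (V := R_NormedModule)); [apply hexp | ].
          apply (is_derive_minus (V := R_NormedModule)); auto.
        * intros s hs. assert (hb := hdiff s ltac:(lra)).
          apply Rabs_le_between in hb. lra. }
  assert (htail : forall n m t, 0 <= t ->
     Rabs (p (n + m)%nat t - p n t) <= 2 * C * (1 / 2) ^ n * exp (2 * K * t)).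
  { intros n m t ht.
    assert (hE := exp_pos (2 * K * t)). set (E := exp (2 * K * t)) in *.
    assert (hn : 0 < (1 / 2) ^ n) by (apply pow_lt; lra).
    assert (h : Rabs (p (n + m)%nat t - p n t)
                <= C * (1 / 2) ^ n * E * (2 - 2 * (1 / 2) ^ m)).
    { induction m as [ | m IH].
      - rewrite Nat.add_0_r, Rminus_diag, Rabs_R0. simpl. lra.
      - rewrite Nat.add_succ_r.
        replace (p (S (n + m)) t - p n t)
          with ((p (S (n + m)) t - p (n + m)%nat t) + (p (n + m)%nat t - p n t)) by ring.
        eapply Rle_trans; [apply Rabs_triang | ].
        assert (h := hstep (n + m)%nat t ht). fold E in h.
        rewrite pow_add in h. simpl. lra. }
    assert (hm : 0 < (1 / 2) ^ m) by (apply pow_lt; lra).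
    assert (0 <= C * (1 / 2) ^ n * E).
    { apply Rmult_le_pos; [apply Rmult_le_pos; lra | lra]. }
    nra. }
  assert (hgeom : forall c eps, 0 < eps -> exists N, forall n, (N <= n)%nat ->
             c * (1 / 2) ^ n < eps).
  { intros c eps heps.
    assert (hl : is_lim_seq (fun n => c * (1 / 2) ^ n) 0).
    { replace (Finite 0) with (Rbar_mult c 0) by (simpl; f_equal; ring).
      apply is_lim_seq_scal_l. apply is_lim_seq_geom. rewrite Rabs_pos_eq; lra. }
    apply is_lim_seq_spec in hl. destruct (hl (mkposreal eps heps)) as [N hN].
    exists N. intros n hn. specialize (hN n hn). simpl in hN.
    apply Rabs_def2 in hN. lra. }
  assert (hconv : forall t, exists l, 0 <= t -> is_lim_seq (fun n => p n t) (Finite l)).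
  { intros t. destruct (Rle_dec 0 t) as [ht | ht]; [ | exists 0; lra].
    assert (hc : ex_finite_lim_seq (fun n => p n t)).
    { apply ex_lim_seq_cauchy_corr. intros eps.
      destruct (hgeom (2 * (2 * C * exp (2 * K * t))) eps (cond_pos eps)) as [N hN].
      exists N. intros n m hn hm.
      replace (p n t - p m t) with ((p n t - p N t) - (p m t - p N t)) by ring.
      assert (h1 := htail N (n - N)%nat t ht). assert (h2 := htail N (m - N)%nat t ht).
      replace (N + (n - N))%nat with n in h1 by lia.
      replace (N + (m - N))%nat with m in h2 by lia.
      specialize (hN N (Nat.le_refl N)).
      apply Rabs_le_between in h1. apply Rabs_le_between in h2.
      apply Rabs_def1; lra. }
    destruct hc as [l hl]. exists l. auto. }
  apply functional_choice in hconv. destruct hconv as [lim hlim].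
  set (phi := fun t => lim (Rmax t 0)).
  assert (hmax : forall t, 0 <= Rmax t 0) by (intros; apply Rmax_r).
  assert (plip : forall n s t, s <= t -> Rabs (p n t - p n s) <= L * (t - s)).
  { intros n s t hst. destruct n as [ | n].
    - change (Rabs (x - x) <= L * (t - s)). rewrite Rminus_diag, Rabs_R0. nra.
    - apply (derive_bound (p (S n)) (fun t => F t (p n t))); auto. }
  assert (llip : forall s t, 0 <= s <= t -> Rabs (lim t - lim s) <= L * (t - s)).
  { intros s t hst.
    apply (lim_seq_abs_le (fun n => p n t - p n s)).
    - apply is_lim_seq_minus'; apply hlim; lra.
    - intros n. apply plip, hst. }
  assert (phic : forall t, continuous phi t).
  { intros t. apply continuous_of_eps. intros eps heps.
    exists (eps / (L + 1)). split; [apply Rdiv_lt_0_compat; lra | ].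
    intros y hy.
    apply Rle_lt_trans with (L * Rabs (y - t)).
    - unfold phi.
      assert (hb : Rabs (Rmax y 0 - Rmax t 0) <= Rabs (y - t)).
      { unfold Rmax, Rabs; repeat destruct Rle_dec; repeat destruct Rcase_abs; lra. }
      destruct (Rle_dec (Rmax t 0) (Rmax y 0)) as [hle | hle].
      + eapply Rle_trans; [apply llip; split; auto | ].
        rewrite Rabs_pos_eq in hb by lra. nra.
      + rewrite Rabs_minus_sym.
        eapply Rle_trans; [apply llip; split; [auto | lra] | ].
        rewrite Rabs_minus_sym, Rabs_pos_eq in hb by lra. nra.
    - apply Rle_lt_trans with ((L + 1) * Rabs (y - t)).
      + assert (h := Rabs_pos (y - t)). nra.
      + apply Rlt_le_trans with ((L + 1) * (eps / (L + 1))); [nra | right; field; lra]. }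
  assert (lim_close : forall n t, 0 <= t ->
     Rabs (lim t - p n t) <= 2 * C * (1 / 2) ^ n * exp (2 * K * t)).
  { intros n t ht.
    apply (lim_seq_abs_le (fun m => p (m + n)%nat t - p n t)).
    - apply is_lim_seq_minus'; [ | apply is_lim_seq_const].
      apply -> (is_lim_seq_incr_n (fun m => p m t) n). apply hlim, ht.
    - intros m. rewrite Nat.add_comm. apply htail, ht. }
  set (u := fun t => x + RInt (fun s => F s (phi s)) 0 t).
  assert (uder : forall t, is_derive u t (F t (phi t))).
  { intros t. apply (derive_RInt_plus (fun s => F s (phi s))). apply hcont, phic. }
  assert (u0 : u 0 = x) by (unfold u; rewrite RInt_0_0; ring).
  assert (hfix : forall t, 0 <= t -> u t = phi t).
  { intros t ht.
    assert (hphi : phi t = lim t) by (unfold phi; rewrite Rmax_left; auto).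
    rewrite hphi. apply cond_eq. intros eps heps.
    set (c := K * (2 * C * exp (2 * K * t))).
    assert (hc : 0 <= c).
    { unfold c. assert (h := exp_pos (2 * K * t)).
      apply Rmult_le_pos; [lra | apply Rmult_le_pos; lra]. }
    destruct (hgeom (c * t + 2 * C * exp (2 * K * t)) eps heps) as [N hN].
    specialize (hN N (Nat.le_refl N)).
    assert (h1 : Rabs ((u t - p (S N) t) - (u 0 - p (S N) 0)) <= c * (1 / 2) ^ N * (t - 0)).
    { apply (derive_bound (fun s => u s - p (S N) s)
               (fun s => F s (phi s) - F s (p N s))); auto.
      - intros s hs. apply (is_derive_minus (V := R_NormedModule)); auto.
      - intros s hs. eapply Rle_trans; [apply hlip | ].
        unfold c. rewrite Rmult_assoc. apply Rmult_le_compat_l; [lra | ].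
        replace (phi s) with (lim s) by (unfold phi; rewrite Rmax_left; lra).
        eapply Rle_trans; [apply lim_close; lra | ].
        assert (hn : 0 < (1 / 2) ^ N) by (apply pow_lt; lra).
        assert (hle : exp (2 * K * s) <= exp (2 * K * t)).
        { destruct (Rle_lt_or_eq_dec (2 * K * s) (2 * K * t)) as [hlt | heq]; [nra | | ].
          - left; apply exp_increasing, hlt.
          - rewrite heq; lra. }
        assert (0 <= 2 * C * (1 / 2) ^ N) by nra. nra. }
    rewrite u0, p0, Rminus_diag, Rminus_0_r, Rminus_0_r in h1.
    assert (h2 := lim_close (S N) t ht).
    assert (hn : 0 < (1 / 2) ^ N) by (apply pow_lt; lra).
    assert (hE := exp_pos (2 * K * t)).
    assert (h3 : 2 * C * (1 / 2) ^ S N * exp (2 * K * t)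
                 <= 2 * C * exp (2 * K * t) * (1 / 2) ^ N).
    { simpl. assert (0 <= C * exp (2 * K * t) * (1 / 2) ^ N); [ | lra].
      apply Rmult_le_pos; [apply Rmult_le_pos | ]; lra. }
    apply Rabs_le_between in h1. apply Rabs_le_between in h2.
    apply Rabs_def1; lra. }
  exists u. split; [exact u0 | split].
  - intros t. eapply derive_continuous, uder.
  - intros t ht. rewrite (hfix t ht). apply uder.
Qed.

(** Stated for the square of e so that only differentiable functions occur: the
    derivative of e^2 is at most (2 K + 1) e^2 + r^2. *)
Lemma gronwall (e d : R -> R) (K r T : R) :
  0 <= K -> 0 <= r ->
  (forall t, 0 <= t <= T -> is_derive e t (d t)) ->
  (forall t, 0 <= t <= T -> Rabs (d t) <= K * Rabs (e t) + r) ->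
  forall t, 0 <= t <= T -> e t ^ 2 <= (e 0 ^ 2 + r ^ 2 * T) * exp ((2 * K + 1) * T).
Proof.
  intros hK hr he hd t ht.
  set (k := 2 * K + 1).
  assert (h : e t ^ 2 * exp (- (k * t)) <= e 0 ^ 2 + r ^ 2 * t).
  { assert (h := derive_mono
      (fun s => r ^ 2 * s - e s ^ 2 * exp (- (k * s)))
      (fun s => r ^ 2 - (2 * e s * d s - k * e s ^ 2) * exp (- (k * s))) 0 t).
    cbv beta in h.
    cut (r ^ 2 * 0 - e 0 ^ 2 * exp (- (k * 0)) <= r ^ 2 * t - e t ^ 2 * exp (- (k * t))).
    { rewrite !Rmult_0_r, Ropp_0, exp_0. lra. }
    apply h; [lra | | ].
    - intros s hs. assert (hs' := he s ltac:(lra)).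
      derive_by_hyps. ring.
    - intros s hs. assert (hs' := hd s ltac:(lra)).
      assert (hexp : 0 < exp (- (k * s)) <= 1).
      { split; [apply exp_pos | ]. rewrite <- exp_0.
        destruct (Rle_lt_or_eq_dec (- (k * s)) 0) as [hlt | heq]; [unfold k; nra | | ].
        - left; apply exp_increasing, hlt.
        - rewrite heq; lra. }
      assert (hq : 2 * e s * d s - k * e s ^ 2 <= r ^ 2).
      { assert (hp : e s * d s <= Rabs (e s) * Rabs (d s)).
        { rewrite <- Rabs_mult. apply Rle_abs. }
        assert (he2 : e s ^ 2 = Rabs (e s) ^ 2) by (rewrite pow2_abs; reflexivity).
        rewrite he2. assert (h0 := Rabs_pos (e s)). unfold k.
        assert (hx : Rabs (e s) * Rabs (d s) <= Rabs (e s) * (K * Rabs (e s) + r))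
          by (apply Rmult_le_compat_l; auto).
        assert (hy := pow2_ge_0 (Rabs (e s) - r)). nra. }
      nra. }
  assert (hE : exp (k * T) >= exp (k * t)).
  { destruct (Rle_lt_or_eq_dec (k * t) (k * T)) as [hlt | heq]; [unfold k; nra | | ].
    - left; apply exp_increasing, hlt.
    - rewrite heq; lra. }
  assert (hEE : exp (- (k * t)) * exp (k * t) = 1).
  { rewrite <- exp_plus, Rplus_opp_l. apply exp_0. }
  assert (h1 := exp_pos (k * t)).
  replace (e t ^ 2) with (e t ^ 2 * exp (- (k * t)) * exp (k * t))
    by (rewrite Rmult_assoc, hEE; ring).
  assert (h2 : 0 <= e 0 ^ 2 + r ^ 2 * t <= e 0 ^ 2 + r ^ 2 * T) by nra.
  apply Rmult_le_compat; try lra.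
  apply Rmult_le_pos; [apply pow2_ge_0 | left; apply exp_pos].
Qed.

(** * The Abel equation: order, uniqueness and perturbation *)

Lemma continuous_Rplus (f g : R -> R) (t : R) :
  continuous f t -> continuous g t -> continuous (fun s => f s + g s) t.
Proof. intros hf hg. exact (continuous_plus (V := R_NormedModule) f g t hf hg). Qed.

Lemma continuous_Rmult (f g : R -> R) (t : R) :
  continuous f t -> continuous g t -> continuous (fun s => f s * g s) t.
Proof. intros hf hg. exact (continuous_mult (K := R_AbsRing) f g t hf hg). Qed.

Lemma continuous_Ropp (f : R -> R) (t : R) :
  continuous f t -> continuous (fun s => - f s) t.
Proof. intros hf. exact (continuous_opp (V := R_NormedModule) f t hf). Qed.

Lemma continuous_Rminus (f g : R -> R) (t : R) :
  continuous f t -> continuous g t -> continuous (fun s => f s - g s) t.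
Proof. intros hf hg. exact (continuous_minus (V := R_NormedModule) f g t hf hg). Qed.

Lemma continuous_pow (f : R -> R) (n : nat) (t : R) :
  continuous f t -> continuous (fun s => f s ^ n) t.
Proof.
  intros hf. induction n as [ | n IH]; simpl.
  - apply continuous_const.
  - apply continuous_Rmult; assumption.
Qed.

Ltac continuity_auto :=
  lazymatch goal with
  | |- continuous (fun s => _ + _) _ => apply continuous_Rplus; continuity_auto
  | |- continuous (fun s => _ - _) _ => apply continuous_Rminus; continuity_auto
  | |- continuous (fun s => _ * _) _ => apply continuous_Rmult; continuity_auto
  | |- continuous (fun s => - _) _ => apply continuous_Ropp; continuity_auto
  | |- continuous (fun s => _ ^ _) _ => apply continuous_pow; continuity_auto
  | |- continuous (fun s => s) _ => apply continuous_id
  | |- _ =>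
      first
        [ match goal with
          | h : forall t, continuous ?g t |- continuous _ ?x => exact (h x)
          end
        | apply continuous_const ]
  end.

(** Solutions are extended beyond the period to continuous functions with two-sided
    derivatives on it, which makes primitives of expressions in u available
    everywhere. *)
Definition sol (A B u : R -> R) : Prop :=
  (forall t, continuous u t) /\
  forall t, period t -> is_derive u t (A t * u t ^ 3 + B t * u t ^ 2).

Lemma period_0 : period 0.
Proof. unfold period. assert (h := PI_RGT_0). lra. Qed.

Lemma period_2PI : period (2 * PI).
Proof. unfold period. assert (h := PI_RGT_0). lra. Qed.

Definition clamp (lo hi t : R) : R := Rmax lo (Rmin hi t).

Lemma clamp_in lo hi t : lo <= hi -> lo <= clamp lo hi t <= hi.
Proof. unfold clamp, Rmax, Rmin; repeat destruct Rle_dec; lra. Qed.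

Lemma clamp_id lo hi t : lo <= t <= hi -> clamp lo hi t = t.
Proof. unfold clamp, Rmax, Rmin; repeat destruct Rle_dec; lra. Qed.

Lemma clamp_lipschitz lo hi s t : lo <= hi ->
  Rabs (clamp lo hi s - clamp lo hi t) <= Rabs (s - t).
Proof.
  unfold clamp, Rmax, Rmin, Rabs; repeat destruct Rle_dec;
    repeat destruct Rcase_abs; lra.
Qed.

Lemma sol_abel (A B u : R -> R) : sol A B u -> abel_solution A B u.
Proof.
  intros [_ hu] t ht. specialize (hu t ht).
  apply is_derive_Reals in hu.
  intros eps heps. destruct (hu eps heps) as [d hd].
  exists d. split; [apply cond_pos | ].
  intros x [[hx hne] hdist]. unfold R_dist in *. simpl in *.
  specialize (hd (x - t)). replace (t + (x - t)) with x in hd by ring.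
  apply hd; [lra | exact hdist].
Qed.

(** The extension is the primitive of the right-hand side along u, where u is
    continued by its end values outside the period. *)
Lemma sol_of_abel (A B u : R -> R) :
  (forall t, continuous A t) -> (forall t, continuous B t) ->
  abel_solution A B u ->
  exists U, sol A B U /\ forall t, period t -> U t = u t.
Proof.
  intros hA hB hu. assert (hpi := PI_RGT_0).
  set (cl := clamp 0 (2 * PI)).
  assert (hcl : forall t, period (cl t)) by (intros t; apply clamp_in; lra).
  assert (hid : forall t, period t -> cl t = t) by (intros t ht; apply clamp_id, ht).
  set (v := fun t => u (cl t)).
  assert (hv : forall t, continuous v t).
  { intros t. apply continuous_of_eps. intros eps heps.
    assert (h := cont_deriv _ _ _ _ (hu (cl t) (hcl t))).
    destruct (h eps heps) as [d [hd hd']]. exists d. split; [exact hd | ].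
    intros y hy. unfold v.
    destruct (Req_dec (cl t) (cl y)) as [heq | hne].
    - rewrite heq, Rminus_diag, Rabs_R0. exact heps.
    - apply hd'. split; [split; auto | ]. simpl. unfold R_dist.
      eapply Rle_lt_trans; [apply clamp_lipschitz; lra | exact hy]. }
  set (f := fun t => A t * v t ^ 3 + B t * v t ^ 2).
  assert (hf : forall t, continuous f t) by (intros t; unfold f; continuity_auto).
  set (U := fun t => u 0 + RInt f 0 t).
  assert (hU : forall t, is_derive U t (f t)) by (apply derive_RInt_plus, hf).
  assert (hUc : forall t, continuous U t) by (intros t; eapply derive_continuous, hU).
  assert (hvd : forall t, 0 < t < 2 * PI -> is_derive v t (f t)).
  { intros t ht. apply is_derive_Reals. intros eps heps.
    assert (hpt : period t) by (unfold period; lra).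
    destruct (hu t hpt eps heps) as [d [hd hd']].
    assert (hm : 0 < Rmin d (Rmin t (2 * PI - t))).
    { repeat apply Rmin_glb_lt; lra. }
    exists (mkposreal _ hm). intros h hh0 hh. simpl in hh.
    assert (hh1 := Rlt_le_trans _ _ _ hh (Rmin_l _ _)).
    assert (hh2 := Rlt_le_trans _ _ _ hh (Rmin_r _ _)).
    assert (hh3 := Rlt_le_trans _ _ _ hh2 (Rmin_l _ _)).
    assert (hh4 := Rlt_le_trans _ _ _ hh2 (Rmin_r _ _)).
    apply Rabs_def2 in hh3. apply Rabs_def2 in hh4.
    assert (hph : period (t + h)) by (unfold period; lra).
    unfold f, v. rewrite (hid t hpt), (hid _ hph).
    specialize (hd' (t + h)). simpl in hd'. unfold R_dist in hd'.
    replace (t + h - t) with h in hd' by ring.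
    apply hd'. repeat split; try apply hph; [lra | exact hh1]. }
  assert (heq : forall t, period t -> U t = v t).
  { intros t ht.
    destruct (MVT_gen (fun s => U s - v s) 0 t (fun _ => 0)) as [c [_ hc]].
    - intros s hs. rewrite Rmin_left, Rmax_right in hs by apply ht.
      destruct ht as [ht1 ht2].
      replace 0 with (f s - f s) by ring.
      apply (is_derive_minus (V := R_NormedModule)); [apply hU | apply hvd; lra].
    - intros s hs. apply continuity_pt_filterlim. apply continuous_Rminus; auto.
    - assert (h0 : U 0 = v 0).
      { unfold U, v. rewrite RInt_0_0, (hid 0 period_0). ring. }
      lra. }
  exists U. split.
  - split; [exact hUc | ]. intros t ht. rewrite (heq t ht). apply hU.
  - intros t ht. rewrite (heq t ht). unfold v. rewrite hid; auto.
Qed.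

(** The difference of two solutions solves a homogeneous linear equation, since
    the right-hand side is a polynomial in u; uniqueness and preservation of
    order follow. *)
Lemma sol_difference (A B u w : R -> R) :
  (forall t, continuous A t) -> (forall t, continuous B t) ->
  sol A B u -> sol A B w ->
  exists k, (forall t, continuous k t) /\
    forall t, period t -> is_derive (fun s => w s - u s) t (k t * (w t - u t)).
Proof.
  intros hA hB [hu hu'] [hw hw'].
  exists (fun t => A t * (w t ^ 2 + w t * u t + u t ^ 2) + B t * (w t + u t)). split.
  - intros t. continuity_auto.
  - intros t ht. assert (h1 := hu' t ht). assert (h2 := hw' t ht).
    derive_by_hyps. ring.
Qed.

Lemma sol_unique (A B u w : R -> R) :
  (forall t, continuous A t) -> (forall t, continuous B t) ->
  sol A B u -> sol A B w -> u 0 = w 0 -> forall t, period t -> u t = w t.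
Proof.
  intros hA hB hu hw h0 t ht.
  destruct (sol_difference A B u w hA hB hu hw) as [k [hk hk']].
  destruct (linear_homogeneous k (fun s => w s - u s) 0 t) as [m [_ hm]]; auto.
  - apply ht.
  - intros s hs. apply hk'. destruct ht. unfold period. lra.
  - cbv beta in hm. rewrite h0 in hm. lra.
Qed.

Lemma sol_lt (A B u w : R -> R) :
  (forall t, continuous A t) -> (forall t, continuous B t) ->
  sol A B u -> sol A B w -> u 0 < w 0 -> forall t, period t -> u t < w t.
Proof.
  intros hA hB hu hw h0 t ht.
  destruct (sol_difference A B u w hA hB hu hw) as [k [hk hk']].
  destruct (linear_homogeneous k (fun s => w s - u s) 0 t) as [m [hm0 hm]]; auto.
  - apply ht.
  - intros s hs. apply hk'. destruct ht. unfold period. lra.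
  - cbv beta in hm. assert (0 < m * (w 0 - u 0)) by (apply Rmult_lt_0_compat; lra). lra.
Qed.

Lemma sol_zero (A B : R -> R) : sol A B (fun _ => 0).
Proof.
  split.
  - intros t. apply continuous_const.
  - intros t _. replace (A t * 0 ^ 3 + B t * 0 ^ 2) with 0 by ring.
    apply (is_derive_const (V := R_NormedModule)).
Qed.

Lemma sol_pos (A B u : R -> R) :
  (forall t, continuous A t) -> (forall t, continuous B t) ->
  sol A B u -> 0 < u 0 -> forall t, period t -> 0 < u t.
Proof.
  intros hA hB hu h0. apply (sol_lt A B (fun _ => 0) u hA hB (sol_zero A B) hu h0).
Qed.

Lemma sol_nonneg (A B u : R -> R) :
  (forall t, continuous A t) -> (forall t, continuous B t) ->
  sol A B u -> 0 <= u 0 -> forall t, period t -> 0 <= u t.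
Proof.
  intros hA hB hu [h0 | h0] t ht.
  - left. apply (sol_pos A B u hA hB hu h0 t ht).
  - right. apply (sol_unique A B (fun _ => 0) u hA hB (sol_zero A B) hu h0 t ht).
Qed.

(** Solves the equation with the unknown clamped to [- M - 1, M + 1].  By Gronwall
    the result stays within 1 of u, so the clamp is never active.  The radius d
    depends only on the bounds C and M, which is what makes limits of solutions
    solutions again. *)
Lemma sol_perturb (C M eta : R) :
  0 < C -> 0 < M -> 0 < eta ->
  exists d, 0 < d /\
  forall A B A' B' u x,
    (forall t, continuous A' t) -> (forall t, continuous B' t) ->
    (forall t, Rabs (A t) <= C) -> (forall t, Rabs (B t) <= C) ->
    (forall t, Rabs (A' t) <= C) -> (forall t, Rabs (B' t) <= C) ->
    (forall t, Rabs (A' t - A t) <= d) -> (forall t, Rabs (B' t - B t) <= d) ->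
    sol A B u -> (forall t, period t -> Rabs (u t) <= M) ->
    Rabs (x - u 0) <= d ->
    exists w, sol A' B' w /\ w 0 = x /\
      forall t, period t -> Rabs (w t - u t) <= eta.
Proof.
  intros hC hM heta. assert (hpi := PI_RGT_0).
  set (M1 := M + 1).
  set (K := 3 * C * M1 ^ 2 + 2 * C * M1).
  assert (hM1 : 0 < M1) by (unfold M1; lra).
  assert (hCM : 0 < C * M1) by (apply Rmult_lt_0_compat; lra).
  assert (hM2 : 0 < M1 ^ 2) by (apply pow_lt; lra).
  assert (hM3 : 0 < M1 ^ 3) by (apply pow_lt; lra).
  assert (hCM2 : 0 < C * M1 ^ 2) by (apply Rmult_lt_0_compat; lra).
  assert (hK : 0 < K) by (unfold K; lra).
  set (r0 := M1 ^ 3 + M1 ^ 2).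
  set (T := 2 * PI).
  assert (hT : 0 < T) by (unfold T; lra).
  set (Z := (1 + r0 ^ 2 * T) * exp ((2 * K + 1) * T)).
  assert (hZ : 1 <= Z).
  { unfold Z. assert (hE : 1 <= exp ((2 * K + 1) * T)).
    { apply Rle_trans with (exp 0); [rewrite exp_0; lra | ]. left. apply exp_increasing.
      apply Rmult_lt_0_compat; lra. }
    assert (hr : 0 <= r0 ^ 2 * T) by (apply Rmult_le_pos; [apply pow2_ge_0 | lra]).
    replace 1 with (1 * 1) at 1 by ring. apply Rmult_le_compat; lra. }
  set (mu := Rmin eta 1).
  assert (hmu : 0 < mu) by (unfold mu; apply Rmin_glb_lt; lra).
  assert (hmu1 : mu <= 1) by apply Rmin_r.
  assert (hmu2 : mu <= eta) by apply Rmin_l.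
  exists (mu / Z). split; [apply Rdiv_lt_0_compat; lra | ].
  intros A B A' B' u x cA' cB' bA bB bA' bB' dA dB [hu hu'] bu hx.
  set (d := mu / Z) in *.
  assert (hd : 0 < d) by (unfold d; apply Rdiv_lt_0_compat; lra).
  set (cl := clamp (- M1) M1).
  assert (bcl : forall y, Rabs (cl y) <= M1).
  { intros y. apply Rabs_le. apply clamp_in. lra. }
  assert (lcl : forall y z, Rabs (cl y - cl z) <= Rabs (y - z)).
  { intros; apply clamp_lipschitz; lra. }
  set (F := fun t y => A' t * cl y ^ 3 + B' t * cl y ^ 2).
  assert (Rabs3 : forall p q r s, Rabs p <= r -> Rabs q <= s -> Rabs (p * q) <= r * s).
  { intros p q r s hp hq. rewrite Rabs_mult.
    apply Rmult_le_compat; auto using Rabs_pos. }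
  assert (b2 : forall y, Rabs (cl y ^ 2) <= M1 ^ 2).
  { intros y. replace (M1 ^ 2) with (M1 * M1) by ring. simpl. rewrite Rmult_1_r. auto. }
  assert (b3 : forall y, Rabs (cl y ^ 3) <= M1 ^ 3).
  { intros y. replace (M1 ^ 3) with (M1 * M1 ^ 2) by ring.
    replace (cl y ^ 3) with (cl y * cl y ^ 2) by ring. auto. }
  assert (hlip : forall t y z, Rabs (F t y - F t z) <= K * Rabs (y - z)).
  { intros t y z. unfold F.
    replace (A' t * cl y ^ 3 + B' t * cl y ^ 2 - (A' t * cl z ^ 3 + B' t * cl z ^ 2))
      with ((A' t * (cl y * cl y + cl y * cl z + cl z * cl z)
             + B' t * (cl y + cl z)) * (cl y - cl z)) by ring.
    apply Rabs3; [ | apply lcl]. unfold K.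
    eapply Rle_trans; [apply Rabs_triang | ].
    replace (3 * C * M1 ^ 2) with (C * (M1 * M1 + M1 * M1 + M1 * M1)) by ring.
    replace (2 * C * M1) with (C * (M1 + M1)) by ring.
    apply Rplus_le_compat; apply Rabs3; auto.
    - eapply Rle_trans; [apply Rabs_triang | ].
      apply Rplus_le_compat; auto.
      eapply Rle_trans; [apply Rabs_triang | ].
      apply Rplus_le_compat; auto.
    - eapply Rle_trans; [apply Rabs_triang | ].
      apply Rplus_le_compat; auto. }
  destruct (picard F K (C * M1 ^ 3 + C * M1 ^ 2) x hK) as [w [hw0 [hwc hwd]]].
  - intros phi hphi t. unfold F.
    assert (hc : forall s, continuous (fun s => cl (phi s)) s).
    { intros s. apply (continuous_comp phi cl); [apply hphi | ].
      apply continuous_of_eps. intros eps heps. exists eps. split; [exact heps | ].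
      intros y hy. eapply Rle_lt_trans; [apply lcl | exact hy]. }
    continuity_auto.
  - intros t y. unfold F. eapply Rle_trans; [apply Rabs_triang | ].
    apply Rplus_le_compat; apply Rabs3; auto.
  - exact hlip.
  - assert (ucl : forall t, period t -> cl (u t) = u t).
    { intros t ht. apply clamp_id. specialize (bu t ht).
      apply Rabs_le_between in bu. unfold M1. lra. }
    assert (hg : forall t, period t -> (w t - u t) ^ 2 <=
      ((w 0 - u 0) ^ 2 + (d * r0) ^ 2 * T) * exp ((2 * K + 1) * T)).
    { apply (gronwall (fun s => w s - u s)
        (fun t => F t (w t) - (A t * u t ^ 3 + B t * u t ^ 2))); [lra | | | ].
      - unfold r0. apply Rmult_le_pos; lra.
      - intros t ht. apply (is_derive_minus (V := R_NormedModule)).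
        + apply hwd, ht.
        + apply hu', ht.
      - intros t ht.
        replace (F t (w t) - (A t * u t ^ 3 + B t * u t ^ 2))
          with ((F t (w t) - F t (u t))
                + ((A' t - A t) * cl (u t) ^ 3 + (B' t - B t) * cl (u t) ^ 2)).
        + eapply Rle_trans; [apply Rabs_triang | ].
          apply Rplus_le_compat; [apply hlip | ].
          eapply Rle_trans; [apply Rabs_triang | ].
          unfold r0. rewrite Rmult_plus_distr_l.
          apply Rplus_le_compat; apply Rabs3; auto.
        + unfold F. rewrite (ucl t ht). ring. }
    assert (hclose : forall t, period t -> Rabs (w t - u t) <= mu).
    { intros t ht. specialize (hg t ht). rewrite hw0 in hg.
      assert (hx2 : (x - u 0) ^ 2 <= d ^ 2).
      { rewrite <- (pow2_abs (x - u 0)). apply pow_incr. split; [apply Rabs_pos | exact hx]. }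
      assert (h1 : (w t - u t) ^ 2 <= d ^ 2 * Z).
      { eapply Rle_trans; [apply hg | ]. unfold Z. rewrite <- Rmult_assoc.
        apply Rmult_le_compat_r; [left; apply exp_pos | ].
        replace ((d * r0) ^ 2) with (d ^ 2 * r0 ^ 2) by ring. lra. }
      assert (h2 : d * Z = mu) by (unfold d; field; lra).
      assert (h3 : d ^ 2 * Z <= mu ^ 2).
      { rewrite <- h2. replace ((d * Z) ^ 2) with (d ^ 2 * Z * Z) by ring.
        assert (hq : 0 <= d ^ 2 * Z) by (apply Rmult_le_pos; [apply pow2_ge_0 | lra]).
        rewrite <- (Rmult_1_r (d ^ 2 * Z)) at 1. apply Rmult_le_compat_l; lra. }
      rewrite <- (Rabs_pos_eq mu) by lra. apply Rsqr_le_abs_0. unfold Rsqr. lra. }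
    exists w. split; [ | split; [exact hw0 | ]].
    + split; [exact hwc | ]. intros t ht.
      assert (hwcl : cl (w t) = w t).
      { apply clamp_id. specialize (bu t ht). specialize (hclose t ht).
        apply Rabs_le_between in bu. apply Rabs_le_between in hclose. unfold M1. lra. }
      assert (h := hwd t (proj1 ht)). unfold F in h. rewrite hwcl in h. exact h.
    + intros t ht. specialize (hclose t ht). lra.
Qed.

(** * Bounds on positive solutions that are uniform in the initial value *)

(** The factorization that makes u sin(t/2) the natural unknown: A contains the
    factor sin(t/2) that vanishes at both ends of the period. *)
Lemma coefA_half (a t : R) :
  coefA a t = 2 * sin (t / 2) * (a * sin (t / 2) - cos (t / 2)).
Proof.
  unfold coefA. replace t with (2 * (t / 2)) at 1 2 by field.
  rewrite sin_2a, cos_2a_sin. ring.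
Qed.

Lemma coefA_derive (a t : R) : is_derive (coefA a) t (- cos t + a * sin t).
Proof. unfold coefA. auto_derive; [auto | ring]. Qed.

Lemma coefB_derive (b b1 b2 t : R) :
  is_derive (coefB b b1 b2) t (b1 * cos t - b2 * sin t).
Proof. unfold coefB. auto_derive; [auto | ring]. Qed.

Lemma coefA_continuous (a t : R) : continuous (coefA a) t.
Proof. eapply derive_continuous, coefA_derive. Qed.

Lemma coefB_continuous (b b1 b2 t : R) : continuous (coefB b b1 b2) t.
Proof. eapply derive_continuous, coefB_derive. Qed.

Lemma Rabs_sin_le (t : R) : Rabs (sin t) <= 1.
Proof. apply Rabs_le. assert (h := SIN_bound t). lra. Qed.

Lemma Rabs_cos_le (t : R) : Rabs (cos t) <= 1.
Proof. apply Rabs_le. assert (h := COS_bound t). lra. Qed.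

Lemma Rabs_mult_le_l (p q : R) : Rabs q <= 1 -> Rabs (p * q) <= Rabs p.
Proof.
  intros hq. rewrite Rabs_mult. rewrite <- (Rmult_1_r (Rabs p)) at 2.
  apply Rmult_le_compat_l; [apply Rabs_pos | exact hq].
Qed.

Lemma coefA_bound (a t : R) : Rabs (coefA a t) <= 1 + 2 * Rabs a.
Proof.
  unfold coefA.
  assert (h1 := Rabs_sin_le t).
  assert (h2 := Rabs_mult_le_l a (cos t) (Rabs_cos_le t)).
  revert h1 h2. unfold Rabs; repeat destruct Rcase_abs; lra.
Qed.

Lemma coefB_bound (b b1 b2 t : R) :
  Rabs (coefB b b1 b2 t) <= Rabs b + Rabs b1 + Rabs b2.
Proof.
  unfold coefB.
  assert (h1 := Rabs_mult_le_l b1 (sin t) (Rabs_sin_le t)).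
  assert (h2 := Rabs_mult_le_l b2 (cos t) (Rabs_cos_le t)).
  eapply Rle_trans; [apply Rabs_triang | ].
  apply Rplus_le_compat; [ | exact h2].
  eapply Rle_trans; [apply Rabs_triang | lra].
Qed.

Lemma coefA_dist (a a' t : R) : Rabs (coefA a' t - coefA a t) <= 2 * Rabs (a' - a).
Proof.
  unfold coefA.
  replace (a' - sin t - a' * cos t - (a - sin t - a * cos t))
    with ((a' - a) * (1 - cos t)) by ring.
  rewrite Rabs_mult, Rmult_comm. apply Rmult_le_compat_r; [apply Rabs_pos | ].
  apply Rabs_le. assert (h := COS_bound t). lra.
Qed.

Lemma coefB_dist (b b' b1 b2 t : R) :
  coefB b' b1 b2 t - coefB b b1 b2 t = b' - b.
Proof. unfold coefB. ring. Qed.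

Lemma sin_half_pos (t : R) : 0 < t < 2 * PI -> 0 < sin (t / 2).
Proof. intros ht. apply sin_gt_0; lra. Qed.

Lemma sin_half_nonneg (t : R) : period t -> 0 <= sin (t / 2).
Proof. intros [h1 h2]. apply sin_ge_0; lra. Qed.

(** The parameters are b1, b2, a0, b0 and the initial value x. *)
Definition flow (b1 b2 a b x : R) (u : R -> R) : Prop :=
  sol (coefA a) (coefB b b1 b2) u /\ u 0 = x.

Lemma flow_unique b1 b2 a b x u w :
  flow b1 b2 a b x u -> flow b1 b2 a b x w -> forall t, period t -> u t = w t.
Proof.
  intros [hu hu0] [hw hw0].
  apply (sol_unique (coefA a) (coefB b b1 b2)); auto using coefA_continuous, coefB_continuous.
  lra.
Qed.

Lemma flow_pos b1 b2 a b x u :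
  0 < x -> flow b1 b2 a b x u -> forall t, period t -> 0 < u t.
Proof.
  intros hx [hu hu0].
  apply (sol_pos (coefA a) (coefB b b1 b2)); auto using coefA_continuous, coefB_continuous.
  lra.
Qed.

Lemma flow_nonneg b1 b2 a b x u :
  0 <= x -> flow b1 b2 a b x u -> forall t, period t -> 0 <= u t.
Proof.
  intros hx [hu hu0].
  apply (sol_nonneg (coefA a) (coefB b b1 b2)); auto using coefA_continuous, coefB_continuous.
  lra.
Qed.

(** With p = u sin(t/2) one has
    p' = u (2 (a sin(t/2) - cos(t/2)) p^2 + B p + cos(t/2) / 2);
    this is the bracket at p = N. *)
Definition barrier (b1 b2 a b N t : R) : R :=
  2 * N ^ 2 * (a * sin (t / 2) - cos (t / 2)) + N * coefB b b1 b2 t + cos (t / 2) / 2.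

(** The quotient by sin(t/2) contains - 2 N^2 cot(t/2), whose growth dominates
    all other terms once N exceeds a multiple of the size of B.  Hence the
    barrier changes sign at most once, from negative to positive. *)
Lemma barrier_sign b1 b2 a b S s t :
  Rabs b + Rabs b1 + Rabs b2 <= S ->
  0 < s -> s <= t -> t < 2 * PI ->
  barrier b1 b2 a b (1 + 2 * S) s / sin (s / 2)
  <= barrier b1 b2 a b (1 + 2 * S) t / sin (t / 2).
Proof.
  intros hS hs hst ht. set (N := 1 + 2 * S).
  assert (hN : 1 + 2 * S = N) by reflexivity.
  assert (hS0 : 0 <= S).
  { assert (h1 := Rabs_pos b). assert (h2 := Rabs_pos b1). assert (h3 := Rabs_pos b2). lra. }
  apply (derive_mono (fun r => barrier b1 b2 a b N r / sin (r / 2))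
    (fun r => (N ^ 2 - 1 / 4 + N * ((b1 * cos r - b2 * sin r) * sin (r / 2)
               - coefB b b1 b2 r * (cos (r / 2) / 2))) / sin (r / 2) ^ 2)); auto.
  - intros r hr. assert (hsin := sin_half_pos r ltac:(lra)).
    assert (hB := coefB_derive b b1 b2 r). unfold barrier.
    auto_derive.
    + repeat split; [eexists; exact hB | lra].
    + derive_rewrite. change (r * / 2) with (r / 2).
      assert (h2 := sin2_cos2 (r / 2)). unfold Rsqr in h2.
      set (p := sin (r / 2)) in *. set (q := cos (r / 2)) in *.
      apply (Rmult_eq_reg_r (p ^ 2)); [ | apply pow_nonzero; lra].
      field_simplify; [ | lra | lra].
      replace (p ^ 2) with (1 - q ^ 2) by lra. field.
  - intros r hr. assert (hsin := sin_half_pos r ltac:(lra)).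
    apply Rdiv_le_0_compat; [ | apply pow_lt, hsin].
    assert (h1 : Rabs ((b1 * cos r - b2 * sin r) * sin (r / 2)) <= Rabs b1 + Rabs b2).
    { eapply Rle_trans; [apply Rabs_mult_le_l, Rabs_sin_le | ].
      eapply Rle_trans; [apply Rabs_triang | ]. rewrite Rabs_Ropp.
      apply Rplus_le_compat; apply Rabs_mult_le_l; [apply Rabs_cos_le | apply Rabs_sin_le]. }
    assert (h2 : Rabs (coefB b b1 b2 r * cos (r / 2)) <= S).
    { eapply Rle_trans; [apply Rabs_mult_le_l, Rabs_cos_le | ].
      eapply Rle_trans; [apply coefB_bound | lra]. }
    assert (h0 := Rabs_pos b).
    apply Rabs_le_between in h1. apply Rabs_le_between in h2.
    set (p := (b1 * cos r - b2 * sin r) * sin (r / 2)) in *.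
    replace (coefB b b1 b2 r * (cos (r / 2) / 2)) with (coefB b b1 b2 r * cos (r / 2) / 2)
      by field.
    set (q := coefB b b1 b2 r * cos (r / 2)) in *.
    assert (h3 : - (3 / 2 * S) <= p - q / 2) by lra.
    assert (h4 : N * (- (3 / 2 * S)) <= N * (p - q / 2)) by (apply Rmult_le_compat_l; lra).
    unfold N in *. nra.
Qed.

(** The function e = u sin(t/2) - N satisfies e' = k e + u Q with Q the barrier.
    It is negative at both ends of the period.  Where Q <= 0 this propagates
    forwards from 0, and where Q >= 0 backwards from 2 pi; since Q changes sign
    once, the two ranges cover the period. *)
Lemma sol_sin_half_bound b1 b2 a b x S u :
  Rabs b + Rabs b1 + Rabs b2 <= S -> 0 <= x -> flow b1 b2 a b x u ->
  forall t, period t -> u t * sin (t / 2) <= 1 + 2 * S.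
Proof.
  intros hS hx hu t ht.
  assert (hpos := flow_nonneg _ _ _ _ _ _ hx hu).
  destruct hu as [[hc hd] h0]. set (N := 1 + 2 * S).
  assert (hS0 : 0 <= S).
  { assert (h1 := Rabs_pos b). assert (h2 := Rabs_pos b1). assert (h3 := Rabs_pos b2). lra. }
  assert (hN : 1 <= N) by (unfold N; lra).
  assert (csin : forall t, continuous (fun t => sin (t / 2)) t).
  { intros r. apply (derive_continuous _ _ (cos (r / 2) / 2)). auto_derive; [auto | unfold Rdiv; ring]. }
  assert (ccos : forall t, continuous (fun t => cos (t / 2)) t).
  { intros r. apply (derive_continuous _ _ (- sin (r / 2) / 2)). auto_derive; [auto | unfold Rdiv; ring]. }
  assert (cB := coefB_continuous b b1 b2).
  set (k := fun t => u t * (2 * (a * sin (t / 2) - cos (t / 2)) * (u t * sin (t / 2) + N)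
                            + coefB b b1 b2 t)).
  assert (hk : forall t, continuous k t) by (intros r; unfold k; continuity_auto).
  assert (he : forall t, period t -> is_derive (fun t => u t * sin (t / 2) - N) t
     (k t * (u t * sin (t / 2) - N) + u t * barrier b1 b2 a b N t)).
  { intros r hr. specialize (hd r hr). auto_derive; [eexists; exact hd | ].
    derive_rewrite. unfold k, barrier. rewrite coefA_half. unfold Rdiv. field. }
  destruct (Req_dec t 0) as [-> | ht0].
  { replace (0 / 2) with 0 by field. rewrite sin_0. lra. }
  destruct (Req_dec t (2 * PI)) as [-> | ht1].
  { replace (2 * PI / 2) with PI by field. rewrite sin_PI. lra. }
  assert (ht' : 0 < t < 2 * PI) by (destruct ht; lra).
  assert (hst := sin_half_pos t ht').
  destruct (Rle_dec (barrier b1 b2 a b N t) 0) as [hb | hb].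
  - destruct (linear_nonpos k (fun t => u t * sin (t / 2) - N)
      (fun t => u t * barrier b1 b2 a b N t) 0 t) as [m [hm hm']]; auto; [lra | | | ].
    + intros r hr. apply he. unfold period. lra.
    + intros r hr. assert (hsr := sin_half_pos r ltac:(lra)).
      assert (h := barrier_sign b1 b2 a b S r t hS ltac:(lra) ltac:(lra) ltac:(lra)).
      fold N in h.
      assert (h1 : barrier b1 b2 a b N t / sin (t / 2) <= 0).
      { unfold Rdiv. assert (h1 := Rinv_0_lt_compat _ hst). nra. }
      assert (h2 : barrier b1 b2 a b N r <= 0).
      { replace (barrier b1 b2 a b N r) with
          (barrier b1 b2 a b N r / sin (r / 2) * sin (r / 2)) by (field; lra). nra. }
      assert (h3 := hpos r ltac:(unfold period; lra)). nra.
    + cbv beta in hm'. replace (0 / 2) with 0 in hm' by field. rewrite sin_0 in hm'. nra.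
  - destruct (linear_nonpos k (fun t => - (u t * sin (t / 2) - N))
      (fun t => - (u t * barrier b1 b2 a b N t)) t (2 * PI)) as [m [hm hm']]; auto; [lra | | | ].
    + intros r hr. specialize (he r ltac:(unfold period; lra)).
      evar_last; [apply (is_derive_opp (V := R_NormedModule)); exact he | ].
      unfold opp; simpl. ring.
    + intros r hr. assert (hsr := sin_half_pos r ltac:(lra)).
      assert (h := barrier_sign b1 b2 a b S t r hS ltac:(lra) ltac:(lra) ltac:(lra)).
      fold N in h.
      assert (h1 : 0 <= barrier b1 b2 a b N t / sin (t / 2)).
      { apply Rdiv_le_0_compat; lra. }
      assert (h2 : 0 <= barrier b1 b2 a b N r).
      { replace (barrier b1 b2 a b N r) with
          (barrier b1 b2 a b N r / sin (r / 2) * sin (r / 2)) by (field; lra). nra. }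
      assert (h3 := hpos r ltac:(unfold period; lra)). nra.
    + cbv beta in hm'. replace (2 * PI / 2) with PI in hm' by field.
      rewrite sin_PI in hm'. nra.
Qed.

(** A bound for the derivative of 1 / u that does not depend on u: in
    (1 / u)' = - (A u + B) the product A u is controlled by u sin(t/2). *)
Definition inverse_speed (a1 S : R) : R := 2 * (a1 + 1) * (1 + 2 * S) + S.

Lemma inverse_speed_pos a1 S : 0 <= a1 -> 0 <= S -> 0 < inverse_speed a1 S.
Proof. intros ha hS. unfold inverse_speed. nra. Qed.

Lemma flow_inv_derive b1 b2 a b x u t :
  0 < x -> flow b1 b2 a b x u -> period t ->
  is_derive (fun s => / u s) t (- (coefA a t * u t + coefB b b1 b2 t)).
Proof.
  intros hx hu ht. assert (hp := flow_pos _ _ _ _ _ _ hx hu t ht).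
  destruct hu as [[_ hd] _]. specialize (hd t ht).
  auto_derive; [split; [eexists; exact hd | lra] | ].
  derive_rewrite. field. lra.
Qed.

Lemma flow_inv_speed b1 b2 a a1 b x S u t :
  0 < x -> flow b1 b2 a b x u -> period t ->
  0 <= a <= a1 -> Rabs b + Rabs b1 + Rabs b2 <= S ->
  Rabs (- (coefA a t * u t + coefB b b1 b2 t)) <= inverse_speed a1 S.
Proof.
  intros hx hu ht ha hS.
  assert (hp := flow_pos _ _ _ _ _ _ hx hu t ht).
  assert (h := sol_sin_half_bound b1 b2 a b x S u hS (Rlt_le _ _ hx) hu t ht).
  assert (hsn := sin_half_nonneg t ht).
  rewrite Rabs_Ropp. eapply Rle_trans; [apply Rabs_triang | ]. unfold inverse_speed.
  apply Rplus_le_compat.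
  - rewrite coefA_half.
    replace (2 * sin (t / 2) * (a * sin (t / 2) - cos (t / 2)) * u t)
      with ((2 * (a * sin (t / 2) - cos (t / 2))) * (u t * sin (t / 2))) by ring.
    rewrite Rabs_mult. apply Rmult_le_compat; try apply Rabs_pos.
    + apply Rabs_le. assert (h1 := SIN_bound (t / 2)). assert (h2 := COS_bound (t / 2)).
      nra.
    + rewrite Rabs_pos_eq; [exact h | ]. apply Rmult_le_pos; lra.
  - eapply Rle_trans; [apply coefB_bound | exact hS].
Qed.

Lemma flow_inv_lipschitz b1 b2 a a1 b x S u s t :
  0 < x -> flow b1 b2 a b x u -> 0 <= s -> s <= t -> t <= 2 * PI ->
  0 <= a <= a1 -> Rabs b + Rabs b1 + Rabs b2 <= S ->
  Rabs (/ u t - / u s) <= inverse_speed a1 S * (t - s).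
Proof.
  intros hx hu hs hst ht ha hS.
  apply (derive_bound (fun r => / u r)
    (fun t => - (coefA a t * u t + coefB b b1 b2 t)) s t); auto.
  - intros r hr. eapply flow_inv_derive; eauto. unfold period; lra.
  - intros r hr. eapply flow_inv_speed; eauto. unfold period; lra.
Qed.

Lemma sin_half_lower (d : R) :
  0 < d -> exists c, 0 < c /\ forall t, d <= t <= 2 * PI - d -> c <= sin (t / 2).
Proof.
  intros hd. destruct (Rle_dec d (2 * PI - d)) as [hle | hle].
  - destruct (continuity_ab_min (fun t => sin (t / 2)) d (2 * PI - d) hle) as [m [hm hm']].
    + intros t _. apply continuity_pt_filterlim.
      apply (derive_continuous (fun t => sin (t / 2)) t (cos (t / 2) / 2)).
      auto_derive; [auto | unfold Rdiv; ring].
    + exists (sin (m / 2)). split; [apply sin_half_pos; lra | exact hm].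
  - exists 1. split; [lra | ]. intros t ht. lra.
Qed.

(** In the middle of the period u is bounded through u sin(t/2).  Near the two ends
    it is bounded because 1 / u has bounded speed and is at least 1 / X there. *)
Lemma flow_bounded b1 b2 a1 S X :
  0 <= a1 -> 0 <= S -> 0 < X ->
  exists M, 0 < M /\ forall a b x u,
    0 <= a <= a1 -> Rabs b + Rabs b1 + Rabs b2 <= S ->
    0 <= x <= X -> flow b1 b2 a b x u -> u (2 * PI) <= X ->
    forall t, period t -> Rabs (u t) <= M.
Proof.
  intros ha1 hS hX. set (L := inverse_speed a1 S).
  assert (hL : 0 < L) by (apply inverse_speed_pos; lra).
  set (d := / (2 * L * X)).
  assert (hd : 0 < d) by (unfold d; apply Rinv_0_lt_compat; nra).
  assert (hLd : L * d = / (2 * X)) by (unfold d; field; lra).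
  assert (hXX : / X = / (2 * X) + / (2 * X)) by (field; lra).
  destruct (sin_half_lower d hd) as [c [hc hc']].
  assert (hNc : 0 < (1 + 2 * S) / c) by (apply Rdiv_lt_0_compat; lra).
  exists (2 * X + (1 + 2 * S) / c). split; [lra | ].
  intros a b x u ha hb hx hu hu2 t ht.
  rewrite Rabs_pos_eq by (apply (flow_nonneg b1 b2 a b x); [lra | exact hu | exact ht]).
  assert (hinv : forall y, 0 < y -> / (2 * X) <= / y -> y <= 2 * X).
  { intros y hy h. rewrite <- (Rinv_inv y), <- (Rinv_inv (2 * X)).
    apply Rinv_le_contravar; [apply Rinv_0_lt_compat; lra | exact h]. }
  destruct (Req_dec x 0) as [h0 | h0].
  { assert (h := flow_unique b1 b2 a b x u (fun _ => 0) hu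
      (conj (sol_zero _ _) (eq_sym h0)) t ht). rewrite h. lra. }
  assert (hx0 : 0 < x) by lra.
  assert (hp := flow_pos _ _ _ _ _ _ hx0 hu).
  destruct ht as [ht1 ht2].
  destruct (Rle_dec t d) as [h1 | h1]; [ | destruct (Rle_dec t (2 * PI - d)) as [h2 | h2]].
  - assert (h := flow_inv_lipschitz b1 b2 a a1 b x S u 0 t hx0 hu
      (Rle_refl 0) ht1 ht2 ha hb). fold L in h.
    replace (u 0) with x in h by (symmetry; apply hu).
    assert (hxi : / X <= / x) by (apply Rinv_le_contravar; lra).
    apply Rabs_le_between in h.
    assert (hh : u t <= 2 * X); [ | lra].
    apply hinv; [apply hp; split; lra | ]. nra.
  - assert (h := sol_sin_half_bound b1 b2 a b x S u hb (proj1 hx) hu t (conj ht1 ht2)).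
    specialize (hc' t ltac:(lra)).
    specialize (hp t (conj ht1 ht2)).
    assert (hh : u t <= (1 + 2 * S) / c); [ | lra].
    apply (Rmult_le_reg_r c); [exact hc | ].
    replace ((1 + 2 * S) / c * c) with (1 + 2 * S) by (field; lra). nra.
  - assert (h := flow_inv_lipschitz b1 b2 a a1 b x S u t (2 * PI) hx0 hu
      ht1 ht2 (Rle_refl _) ha hb). fold L in h.
    assert (hxi : / X <= / u (2 * PI)).
    { apply Rinv_le_contravar; [apply hp, period_2PI | exact hu2]. }
    apply Rabs_le_between in h.
    assert (hh : u t <= 2 * X); [ | lra].
    apply hinv; [apply hp; split; lra | ]. nra.
Qed.

(** * Openness, closedness and monotonicity of the sign of the displacement *)

Lemma flow_near b1 b2 r M eta :
  0 < r -> 0 < M -> 0 < eta ->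
  exists d, 0 < d /\ forall a b x a' b' x' u,
    Rabs a <= r -> Rabs b <= r -> Rabs a' <= r -> Rabs b' <= r ->
    Rabs (a' - a) <= d -> Rabs (b' - b) <= d -> Rabs (x' - x) <= d ->
    flow b1 b2 a b x u -> (forall t, period t -> Rabs (u t) <= M) ->
    exists w, flow b1 b2 a' b' x' w /\
      forall t, period t -> Rabs (w t - u t) <= eta.
Proof.
  intros hr hM heta.
  assert (h1 := Rabs_pos b1). assert (h2 := Rabs_pos b2).
  destruct (sol_perturb (1 + 2 * r + (r + Rabs b1 + Rabs b2)) M eta) as [d [hd hd']]; try lra.
  exists (d / 2). split; [lra | ].
  intros a b x a' b' x' u ha hb ha' hb' daa dbb dxx [hu hu0] hM'.
  destruct (hd' (coefA a) (coefB b b1 b2) (coefA a') (coefB b' b1 b2) u x')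
    as [w [hw [hw0 hwu]]]; auto using coefA_continuous, coefB_continuous.
  - intros t. assert (h := coefA_bound a t). lra.
  - intros t. assert (h := coefB_bound b b1 b2 t). lra.
  - intros t. assert (h := coefA_bound a' t). lra.
  - intros t. assert (h := coefB_bound b' b1 b2 t). lra.
  - intros t. assert (h := coefA_dist a a' t). lra.
  - intros t. rewrite coefB_dist. lra.
  - rewrite hu0. lra.
  - exists w. split; [split; assumption | exact hwu].
Qed.

Lemma flow_bound_exists b1 b2 a b x u :
  flow b1 b2 a b x u -> exists M, 0 < M /\ forall t, period t -> Rabs (u t) <= M.
Proof.
  intros [[hc _] _]. assert (hpi := PI_RGT_0).
  destruct (continuity_ab_maj (fun t => Rabs (u t)) 0 (2 * PI)) as [m [hm _]]; [lra | | ].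
  - intros t _. apply continuity_pt_filterlim.
    apply (continuous_comp u Rabs); [apply hc | apply continuous_Rabs].
  - exists (Rabs (u m) + 1). split.
    + assert (h := Rabs_pos (u m)). lra.
    + intros t ht. specialize (hm t ht). simpl in hm. lra.
Qed.

Lemma flow_open b1 b2 a b x u eta :
  0 < eta -> flow b1 b2 a b x u ->
  exists d, 0 < d /\ forall a' b' x',
    Rabs (a' - a) <= d -> Rabs (b' - b) <= d -> Rabs (x' - x) <= d ->
    exists w, flow b1 b2 a' b' x' w /\
      forall t, period t -> Rabs (w t - u t) <= eta.
Proof.
  intros heta hu. destruct (flow_bound_exists _ _ _ _ _ _ hu) as [M [hM hM']].
  assert (h1 := Rabs_pos a). assert (h2 := Rabs_pos b).
  destruct (flow_near b1 b2 (Rabs a + Rabs b + 1) M eta) as [d [hd hd']]; try lra.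
  exists (Rmin d 1). split; [apply Rmin_glb_lt; lra | ].
  intros a' b' x' ha hb hx.
  assert (hm1 := Rmin_l d 1). assert (hm2 := Rmin_r d 1).
  apply (hd' a b x a' b' x' u); auto; try lra.
  - replace a' with ((a' - a) + a) by ring.
    eapply Rle_trans; [apply Rabs_triang | lra].
  - replace b' with ((b' - b) + b) by ring.
    eapply Rle_trans; [apply Rabs_triang | lra].
Qed.

Definition defined b1 b2 a b x : Prop := exists u, flow b1 b2 a b x u.
(** Existence up to 2 pi is part of the condition, so that a solution that blows
    up earlier counts as displaced upwards. *)
Definition returns_le b1 b2 a b x : Prop :=
  exists u, flow b1 b2 a b x u /\ u (2 * PI) <= x.
Definition returns_lt b1 b2 a b x : Prop :=
  exists u, flow b1 b2 a b x u /\ u (2 * PI) < x.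

Lemma returns_lt_le b1 b2 a b x : returns_lt b1 b2 a b x -> returns_le b1 b2 a b x.
Proof. intros [u [hu h]]. exists u. split; [exact hu | lra]. Qed.

Lemma returns_lt_open b1 b2 a b x :
  returns_lt b1 b2 a b x ->
  exists d, 0 < d /\ forall a' b' x',
    Rabs (a' - a) <= d -> Rabs (b' - b) <= d -> Rabs (x' - x) <= d ->
    returns_lt b1 b2 a' b' x'.
Proof.
  intros [u [hu hlt]].
  destruct (flow_open b1 b2 a b x u ((x - u (2 * PI)) / 4)) as [d [hd hd']]; [lra | exact hu | ].
  exists (Rmin d ((x - u (2 * PI)) / 4)). split; [apply Rmin_glb_lt; lra | ].
  intros a' b' x' ha hb hx.
  assert (hm1 := Rmin_l d ((x - u (2 * PI)) / 4)).
  assert (hm2 := Rmin_r d ((x - u (2 * PI)) / 4)).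
  destruct (hd' a' b' x') as [w [hw hwu]]; try lra.
  exists w. split; [exact hw | ].
  specialize (hwu _ period_2PI).
  apply Rabs_le_between in hwu.
  assert (hx' : Rabs (x' - x) <= (x - u (2 * PI)) / 4) by lra.
  apply Rabs_le_between in hx'. lra.
Qed.

(** Solutions whose return does not exceed the initial value are uniformly
    bounded, so one of them close enough to the limit parameters yields a
    solution there.  The property P is carried along to describe the
    approximating solutions. *)
Lemma returns_le_limit b1 b2 a b x (P : R -> R -> R -> (R -> R) -> Prop) :
  0 <= a -> 0 <= x ->
  (forall d, 0 < d -> exists a' b' x' w,
     0 <= a' /\ 0 <= x' /\
     Rabs (a' - a) <= d /\ Rabs (b' - b) <= d /\ Rabs (x' - x) <= d /\
     flow b1 b2 a' b' x' w /\ w (2 * PI) <= x' /\ P a' b' x' w) ->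
  exists u, flow b1 b2 a b x u /\
    forall eta, 0 < eta -> exists a' b' x' w,
     Rabs (a' - a) <= eta /\ Rabs (b' - b) <= eta /\ Rabs (x' - x) <= eta /\
     flow b1 b2 a' b' x' w /\ w (2 * PI) <= x' /\ P a' b' x' w /\
     forall t, period t -> Rabs (w t - u t) <= eta.
Proof.
  intros ha hx happrox.
  assert (h1 := Rabs_pos b). assert (h2 := Rabs_pos b1). assert (h3 := Rabs_pos b2).
  assert (h0 := Rabs_pos a).
  destruct (flow_bounded b1 b2 (a + 1) (Rabs b + 1 + Rabs b1 + Rabs b2) (x + 1))
    as [M [hM hM']]; try lra.
  assert (hkey : forall eta, 0 < eta -> exists a' b' x' w u,
     Rabs (a' - a) <= eta /\ Rabs (b' - b) <= eta /\ Rabs (x' - x) <= eta /\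
     flow b1 b2 a' b' x' w /\ w (2 * PI) <= x' /\ P a' b' x' w /\ flow b1 b2 a b x u /\
     forall t, period t -> Rabs (w t - u t) <= eta).
  { intros eta heta.
    destruct (flow_near b1 b2 (Rabs a + Rabs b + 1) M eta) as [d [hd hd']]; try lra.
    set (d1 := Rmin d (Rmin 1 eta)).
    assert (hm1 : d1 <= d) by apply Rmin_l.
    assert (hm2 : d1 <= 1) by (eapply Rle_trans; [apply Rmin_r | apply Rmin_l]).
    assert (hm3 : d1 <= eta) by (eapply Rle_trans; [apply Rmin_r | apply Rmin_r]).
    destruct (happrox d1) as [a' [b' [x' [w [ha' [hx' [da [db [dx [hw [hw2 hP]]]]]]]]]]].
    { unfold d1. repeat apply Rmin_glb_lt; lra. }
    assert (Rabs a' <= Rabs a + 1).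
    { replace a' with ((a' - a) + a) by ring.
      eapply Rle_trans; [apply Rabs_triang | lra]. }
    assert (Rabs b' <= Rabs b + 1).
    { replace b' with ((b' - b) + b) by ring.
      eapply Rle_trans; [apply Rabs_triang | lra]. }
    destruct (hd' a' b' x' a b x w) as [u [hu hu']]; try lra; auto.
    - rewrite Rabs_minus_sym. lra.
    - rewrite Rabs_minus_sym. lra.
    - rewrite Rabs_minus_sym. lra.
    - apply Rabs_le_between in da. apply Rabs_le_between in dx.
      apply (hM' a' b' x' w); auto; lra.
    - exists a', b', x', w, u. splits; auto; try lra.
      intros t ht. rewrite Rabs_minus_sym. auto. }
  destruct (hkey 1 Rlt_0_1) as [_ [_ [_ [_ [u [_ [_ [_ [_ [_ [_ [hu _]]]]]]]]]]]].
  exists u. split; [exact hu | ]. intros eta heta.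
  destruct (hkey eta heta) as [a' [b' [x' [w [v [q1 [q2 [q3 [q4 [q5 [q6 [q7 q8]]]]]]]]]]]].
  exists a', b', x', w. splits; auto.
  intros t ht. rewrite (flow_unique _ _ _ _ _ _ _ hu q7 t ht). auto.
Qed.

Lemma returns_le_closed b1 b2 a b x :
  0 <= a -> 0 <= x ->
  (forall d, 0 < d -> exists a' b' x', 0 <= a' /\ 0 <= x' /\
     Rabs (a' - a) <= d /\ Rabs (b' - b) <= d /\ Rabs (x' - x) <= d /\
     returns_le b1 b2 a' b' x') ->
  returns_le b1 b2 a b x.
Proof.
  intros ha hx h.
  destruct (returns_le_limit b1 b2 a b x (fun _ _ _ _ => True) ha hx) as [u [hu hlim]].
  - intros d hd. destruct (h d hd) as [a' [b' [x' [p1 [p2 [p3 [p4 [p5 [w [p6 p7]]]]]]]]]].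
    exists a', b', x', w. splits; auto.
  - exists u. split; [exact hu | ]. apply Rnot_lt_le. intros hlt.
    destruct (hlim ((u (2 * PI) - x) / 4)) as [a' [b' [x' [w [_ [_ [q3 [_ [q5 [_ q7]]]]]]]]]]; [lra | ].
    specialize (q7 _ period_2PI).
    apply Rabs_le_between in q3. apply Rabs_le_between in q7. lra.
Qed.

(** Along a path of parameters, a solution with return at most its initial value
    cannot cease to exist: existence is an open condition, and the sign
    condition is closed. *)
Lemma continuation b1 b2 (a b x : R -> R) :
  (forall s, continuous a s) -> (forall s, continuous b s) -> (forall s, continuous x s) ->
  (forall s, 0 <= s <= 1 -> 0 <= a s) -> (forall s, 0 <= s <= 1 -> 0 <= x s) ->
  defined b1 b2 (a 0) (b 0) (x 0) ->
  (forall s u, 0 <= s <= 1 -> flow b1 b2 (a s) (b s) (x s) u -> u (2 * PI) <= x s) ->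
  returns_le b1 b2 (a 1) (b 1) (x 1).
Proof.
  intros ca cb cx ha hx [u0 hu0] hle.
  set (E := fun s => 0 <= s <= 1 /\ forall r, 0 <= r <= s -> returns_le b1 b2 (a r) (b r) (x r)).
  assert (hE0 : E 0).
  { split; [lra | ]. intros r hr. replace r with 0 by lra.
    exists u0. split; [exact hu0 | apply hle; [lra | exact hu0]]. }
  destruct (completeness E) as [m [hm1 hm2]].
  { exists 1. intros s [hs _]. lra. }
  { exists 0. exact hE0. }
  assert (hm0 : 0 <= m) by (apply hm1, hE0).
  assert (hmle1 : m <= 1) by (apply hm2; intros s [hs _]; lra).
  assert (hbelow : forall r, 0 <= r < m -> returns_le b1 b2 (a r) (b r) (x r)).
  { intros r hr. apply NNPP. intros hn.
    assert (m <= r); [ | lra]. apply hm2. intros s [hs hs'].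
    apply Rnot_lt_le. intros hrs. apply hn, hs'. lra. }
  assert (hcont : forall d, 0 < d -> exists e, 0 < e /\ forall s, Rabs (s - m) < e ->
    Rabs (a s - a m) <= d /\ Rabs (b s - b m) <= d /\ Rabs (x s - x m) <= d).
  { intros d hd.
    destruct (eps_of_continuous a m (ca m) d hd) as [e1 [he1 h1]].
    destruct (eps_of_continuous b m (cb m) d hd) as [e2 [he2 h2]].
    destruct (eps_of_continuous x m (cx m) d hd) as [e3 [he3 h3]].
    exists (Rmin e1 (Rmin e2 e3)). split; [repeat apply Rmin_glb_lt; auto | ].
    intros s hs.
    assert (hs1 := Rlt_le_trans _ _ _ hs (Rmin_l _ _)).
    assert (hs2 := Rlt_le_trans _ _ _ hs (Rmin_r _ _)).
    assert (hs3 := Rlt_le_trans _ _ _ hs2 (Rmin_l _ _)).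
    assert (hs4 := Rlt_le_trans _ _ _ hs2 (Rmin_r _ _)).
    specialize (h1 s hs1). specialize (h2 s hs3). specialize (h3 s hs4). lra. }
  assert (hatm : returns_le b1 b2 (a m) (b m) (x m)).
  { destruct (Req_dec m 0) as [-> | hne].
    { apply (proj2 hE0). lra. }
    apply returns_le_closed; [apply ha; lra | apply hx; lra | ].
    intros d hd. destruct (hcont d hd) as [e [he he']].
    set (r := Rmax 0 (m - e / 2)).
    assert (hr : 0 <= r < m) by (unfold r, Rmax; destruct Rle_dec; lra).
    assert (hr2 : Rabs (r - m) < e).
    { unfold r, Rmax, Rabs; destruct Rle_dec; destruct Rcase_abs; lra. }
    destruct (he' r hr2) as [k1 [k2 k3]].
    exists (a r), (b r), (x r). splits; auto; [apply ha; lra | apply hx; lra]. }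
  destruct (Req_dec m 1) as [h1 | h1]; [rewrite <- h1; exact hatm | ].
  exfalso. destruct hatm as [u [hu _]].
  destruct (flow_open b1 b2 (a m) (b m) (x m) u 1 Rlt_0_1 hu) as [d [hd hd']].
  destruct (hcont d hd) as [e [he he']].
  set (s := Rmin 1 (m + e / 2)).
  assert (hs : m < s /\ s <= 1 /\ s < m + e).
  { unfold s, Rmin; destruct Rle_dec; lra. }
  assert (hEs : E s).
  { split; [lra | ]. intros r hr. destruct (Rlt_dec r m) as [hrm | hrm].
    - apply hbelow. lra.
    - destruct (he' r) as [k1 [k2 k3]].
      { unfold Rabs; destruct Rcase_abs; lra. }
      destruct (hd' (a r) (b r) (x r) k1 k2 k3) as [w [hw _]].
      exists w. split; [exact hw | apply hle; [lra | exact hw]]. }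
  specialize (hm1 s hEs). lra.
Qed.

Lemma flow_compare b1 b2 a b a' b' x u w :
  0 < x -> a' <= a -> b' <= b -> a' < a \/ b' < b ->
  flow b1 b2 a b x u -> flow b1 b2 a' b' x w -> w (2 * PI) < u (2 * PI).
Proof.
  intros hx ha hb hlt hu hw. assert (hpi := PI_RGT_0).
  assert (hpos := flow_pos _ _ _ _ _ _ hx hw).
  destruct hu as [[hu hu'] hu0]. destruct hw as [[hw hw'] hw0].
  assert (cA := coefA_continuous a). assert (cB := coefB_continuous b b1 b2).
  destruct (linear_neg
    (fun t => coefA a t * (w t ^ 2 + w t * u t + u t ^ 2) + coefB b b1 b2 t * (w t + u t))
    (fun t => w t - u t)
    (fun t => (a' - a) * (1 - cos t) * w t ^ 3 + (b' - b) * w t ^ 2) 0 (2 * PI))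
    as [m [hm hm']]; [lra | | | | ].
  - intros t. continuity_auto.
  - intros t ht. assert (h1 := hu' t ht). assert (h2 := hw' t ht).
    derive_by_hyps. unfold coefA, coefB. ring.
  - intros t ht. assert (hp := hpos t ltac:(unfold period; lra)).
    assert (hcos : 0 < 1 - cos t).
    { replace t with (2 * (t / 2)) by field. rewrite cos_2a_sin.
      assert (hs := sin_half_pos t ht). nra. }
    assert (h2 : 0 < w t ^ 2) by (apply pow_lt, hp).
    assert (h3 : 0 < (1 - cos t) * w t ^ 3).
    { apply Rmult_lt_0_compat; [exact hcos | apply pow_lt, hp]. }
    rewrite Rmult_assoc. destruct hlt; nra.
  - cbv beta in hm'. rewrite hu0, hw0 in hm'. lra.
Qed.

Lemma returns_mono b1 b2 a b a' b' x :
  0 < x -> 0 <= a' -> a' <= a -> b' <= b -> a' < a \/ b' < b ->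
  returns_le b1 b2 a b x -> returns_lt b1 b2 a' b' x.
Proof.
  intros hx ha' ha hb hlt [u [hu hux]].
  assert (hle : returns_le b1 b2 (a + 1 * (a' - a)) (b + 1 * (b' - b)) x).
  { apply (continuation b1 b2 (fun s => a + s * (a' - a)) (fun s => b + s * (b' - b))
      (fun _ => x)); try (intros s; continuity_auto).
    - intros s hs. nra.
    - intros s hs. lra.
    - exists u. replace (a + 0 * (a' - a)) with a by ring.
      replace (b + 0 * (b' - b)) with b by ring. exact hu.
    - intros s w hs hw. destruct (Req_dec s 0) as [-> | hs0].
      + replace (a + 0 * (a' - a)) with a in hw by ring.
        replace (b + 0 * (b' - b)) with b in hw by ring.
        rewrite (flow_unique _ _ _ _ _ _ _ hw hu _ period_2PI). exact hux.
      + assert (h := flow_compare b1 b2 a b (a + s * (a' - a)) (b + s * (b' - b)) x u w hx).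
        assert (w (2 * PI) < u (2 * PI)); [ | lra].
        apply h; auto; [nra | nra | ]. destruct hlt; [left | right]; nra. }
  replace (a + 1 * (a' - a)) with a' in hle by ring.
  replace (b + 1 * (b' - b)) with b' in hle by ring.
  destruct hle as [w [hw _]]. exists w. split; [exact hw | ].
  assert (h := flow_compare b1 b2 a b a' b' x u w hx ha hb hlt hu hw). lra.
Qed.

(** For a0 = 0 reflect the solution in t = pi.  With y = 1 / u and
    g(t) = 2 b (t - pi) + 2 b2 sin t >= 0 on [0, pi], the difference
    d(t) = y(2 pi - t) - y(t) - g(t) satisfies d' = k (d + g) with k <= 0
    and d(pi) = 0, so d(0) >= 0, that is
    1 / u(2 pi) - 1 / u(0) >= - 2 pi b > 0. *)
Lemma a0_zero_decreases b1 b2 b x u :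
  0 <= b2 -> b < 0 -> 0 < x -> flow b1 b2 0 b x u -> u (2 * PI) < x.
Proof.
  intros hb2 hb hx hu. assert (hpi := PI_RGT_0).
  assert (hpos := flow_pos _ _ _ _ _ _ hx hu).
  assert (hder : forall t, period t -> is_derive (fun s => / u s) t
     (- (coefA 0 t * u t + coefB b b1 b2 t))).
  { intros t ht. exact (flow_inv_derive b1 b2 0 b x u t hx hu ht). }
  set (g := fun t => 2 * b * (t - PI) + 2 * b2 * sin t).
  set (k := fun t => - (sin (clamp 0 PI t) * u (clamp 0 PI t) * u (2 * PI - clamp 0 PI t))).
  assert (hcl : forall t, continuous (clamp 0 PI) t).
  { intros t. apply continuous_of_eps. intros eps heps. exists eps. split; [exact heps | ].
    intros y hy. eapply Rle_lt_trans; [apply clamp_lipschitz; lra | exact hy]. }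
  assert (huc : forall t, continuous u t) by apply hu.
  assert (hk : forall t, continuous k t).
  { intros t. unfold k.
    assert (c1 : continuous (fun t => sin (clamp 0 PI t)) t).
    { apply (continuous_comp (clamp 0 PI) sin); [apply hcl | apply continuous_sin]. }
    assert (c2 : continuous (fun t => u (clamp 0 PI t)) t).
    { apply (continuous_comp (clamp 0 PI) u); [apply hcl | apply huc]. }
    assert (c3 : continuous (fun t => u (2 * PI - clamp 0 PI t)) t).
    { apply (continuous_comp (fun t => 2 * PI - clamp 0 PI t) u); [ | apply huc].
      apply continuous_Rminus; [apply continuous_const | apply hcl]. }
    apply continuous_Ropp. apply continuous_Rmult; [apply continuous_Rmult | ]; assumption. }
  destruct (linear_nonpos k (fun t => / u (2 * PI - t) - / u t - g t)
    (fun t => k t * g t) 0 PI) as [m [hm hm']]; auto; [lra | | | ].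
  - intros t ht.
    assert (d1 := hder t ltac:(unfold period; lra)).
    assert (d2 := hder (2 * PI - t) ltac:(unfold period; lra)).
    assert (d3 : is_derive (fun s => / u (2 * PI - s)) t
      (coefA 0 (2 * PI - t) * u (2 * PI - t) + coefB b b1 b2 (2 * PI - t))).
    { evar_last.
      - apply (is_derive_comp (fun s => / u s) (fun s => 2 * PI - s)); [exact d2 | ].
        auto_derive; [auto | reflexivity].
      - unfold scal; simpl; unfold mult; simpl. ring. }
    assert (d4 : is_derive g t (2 * b + 2 * b2 * cos t)).
    { unfold g. auto_derive; [auto | ring]. }
    evar_last.
    + apply (is_derive_minus (V := R_NormedModule)); [ | exact d4].
      apply (is_derive_minus (V := R_NormedModule)); [exact d3 | exact d1].
    + assert (p1 := hpos t ltac:(unfold period; lra)).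
      assert (p2 := hpos (2 * PI - t) ltac:(unfold period; lra)).
      unfold minus, plus, opp; simpl. unfold k. rewrite clamp_id by lra.
      assert (hs : sin (2 * PI - t) = - sin t).
      { rewrite sin_minus, sin_2PI, cos_2PI. ring. }
      assert (hc : cos (2 * PI - t) = cos t).
      { rewrite cos_minus, sin_2PI, cos_2PI. ring. }
      unfold coefA, coefB. rewrite hs, hc. field. lra.
  - intros t ht.
    assert (p1 := hpos t ltac:(unfold period; lra)).
    assert (p2 := hpos (2 * PI - t) ltac:(unfold period; lra)).
    assert (hs : 0 < sin t) by (apply sin_gt_0; lra).
    assert (hg : 0 <= g t) by (unfold g; nra).
    unfold k. rewrite clamp_id by lra.
    assert (0 <= sin t * u t * u (2 * PI - t)).
    { apply Rmult_le_pos; [apply Rmult_le_pos | ]; lra. }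
    nra.
  - cbv beta in hm'. unfold g in hm'.
    replace (2 * PI - PI) with PI in hm' by ring.
    rewrite sin_PI, sin_0, Rminus_0_r in hm'.
    replace (u 0) with x in hm' by (symmetry; apply hu).
    assert (h : / x < / u (2 * PI)).
    { assert (hbp : 0 < - (b * PI)) by nra.
      assert (h : 0 <= / u (2 * PI) - / x - (2 * b * (0 - PI) + 2 * b2 * 0)) by nra.
      lra. }
    apply Rnot_le_lt. intros hle.
    assert (h2 := Rinv_le_contravar _ _ hx hle). lra.
Qed.

(** * Expansion of the return map at a closed solution *)

(** For a closed solution exp (G (2 pi)) is the derivative of the return map,
    because (u / u(0))^2 exp G solves the variational equation. *)
Definition log_multiplier (a : R) (u G : R -> R) : Prop :=
  G 0 = 0 /\ forall t, is_derive G t (coefA a t * u t ^ 2).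

(** At a singular solution H (2 pi) / x^2 is half of the second derivative of the
    return map. *)
Definition curvature (a : R) (u G H : R -> R) : Prop :=
  H 0 = 0 /\ forall t, is_derive H t (coefA a t * u t ^ 3 * exp (G t)).

Lemma log_multiplier_exists a u :
  (forall t, continuous u t) -> exists G, log_multiplier a u G.
Proof.
  intros hu. assert (cA := coefA_continuous a).
  apply primitive. intros t. continuity_auto.
Qed.

Lemma curvature_exists a u G :
  (forall t, continuous u t) -> log_multiplier a u G -> exists H, curvature a u G H.
Proof.
  intros hu [_ hG]. assert (cA := coefA_continuous a).
  assert (cG : forall t, continuous (fun t => exp (G t)) t).
  { intros t. apply (continuous_comp G exp); [eapply derive_continuous, hG | ].
    eapply derive_continuous, is_derive_exp. }
  apply primitive. intros t. continuity_auto.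
Qed.

(** Exact form of the second-order expansion of the flow.  For the difference
    delta = w - u and the solution E of the variational equation,
    (E / delta)' = - (3 A u + B) E - A delta E, and (3 A u + B) E is the
    derivative of (u e^G + H) / x^2. *)
Lemma variation_formula b1 b2 a b x u w G H t :
  0 < x -> flow b1 b2 a b x u -> sol (coefA a) (coefB b b1 b2) w ->
  log_multiplier a u G -> curvature a u G H -> period t -> w t <> u t ->
  is_derive (fun s => (u s / x) ^ 2 * exp (G s) / (w s - u s)
                      + (u s * exp (G s) + H s) / x ^ 2) t
    (- (coefA a t * (w t - u t) * ((u t / x) ^ 2 * exp (G t)))).
Proof.
  intros hx [[_ hu] _] [_ hw] [_ hG] [_ hH] ht hne.
  specialize (hu t ht). specialize (hw t ht). specialize (hG t). specialize (hH t).
  auto_derive.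
  - repeat split; try (eexists; eassumption); lra.
  - derive_rewrite. field. split; lra.
Qed.

(** Integrating variation_formula relates the reciprocals of the initial and final
    displacements up to an error controlled by the distance eta of the solutions. *)
Lemma return_expansion b1 b2 a b x u G H :
  0 < x -> flow b1 b2 a b x u -> u (2 * PI) = x ->
  log_multiplier a u G -> curvature a u G H ->
  exists C, 0 <= C /\ forall x' w eta, x' <> x -> flow b1 b2 a b x' w ->
    (forall t, period t -> Rabs (w t - u t) <= eta) ->
    0 < (x' - x) * (w (2 * PI) - x) /\
    Rabs (exp (G (2 * PI)) / (w (2 * PI) - x) - / (x' - x)
          + (x * exp (G (2 * PI)) - x + H (2 * PI)) / x ^ 2) <= C * eta.
Proof.
  intros hx hu hcl hG hH. assert (hpi := PI_RGT_0).
  set (p := fun t => coefA a t * ((u t / x) ^ 2 * exp (G t))).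
  assert (cA := coefA_continuous a). assert (cB := coefB_continuous b b1 b2).
  assert (cu : forall t, continuous u t) by apply hu.
  assert (cG : forall t, continuous (fun t => exp (G t)) t).
  { intros t. apply (continuous_comp G exp); [eapply derive_continuous, hG | ].
    eapply derive_continuous, is_derive_exp. }
  assert (cp : forall t, continuous (fun t => Rabs (p t)) t).
  { intros t. apply (continuous_comp p Rabs); [ | apply continuous_Rabs].
    unfold p, Rdiv. continuity_auto. }
  destruct (continuity_ab_maj (fun t => Rabs (p t)) 0 (2 * PI)) as [m [hm _]]; [lra | | ].
  { intros t _. apply continuity_pt_filterlim, cp. }
  exists (Rabs (p m) * (2 * PI)). split.
  { apply Rmult_le_pos; [apply Rabs_pos | lra]. }
  intros x' w eta hne hw heta.
  assert (hsign : forall t, period t -> 0 < (x' - x) * (w t - u t)).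
  { intros t ht. destruct hu as [hu hu0]. destruct hw as [hw hw0].
    destruct (Rtotal_order x x') as [h | [h | h]]; [ | lra | ].
    - assert (h1 := sol_lt _ _ u w cA cB hu hw ltac:(lra) t ht). nra.
    - assert (h1 := sol_lt _ _ w u cA cB hw hu ltac:(lra) t ht). nra. }
  assert (h2 := hsign _ period_2PI). rewrite hcl in h2.
  split; [exact h2 | ].
  assert (hb := derive_bound
    (fun s => (u s / x) ^ 2 * exp (G s) / (w s - u s) + (u s * exp (G s) + H s) / x ^ 2)
    (fun t => - (coefA a t * (w t - u t) * ((u t / x) ^ 2 * exp (G t))))
    0 (2 * PI) (Rabs (p m) * eta) ltac:(lra)).
  cbv beta in hb.
  rewrite hcl, (proj1 hG), (proj1 hH) in hb.
  replace (u 0) with x in hb by (symmetry; apply hu).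
  replace (w 0) with x' in hb by (symmetry; apply hw).
  rewrite exp_0 in hb.
  assert (hx1 : x' - x <> 0) by lra.
  assert (hx2 : w (2 * PI) - x <> 0) by nra.
  match goal with |- Rabs ?e <= _ =>
    match type of hb with _ -> _ -> Rabs ?f <= _ => replace f with e in hb end end.
  - replace (Rabs (p m) * (2 * PI) * eta) with (Rabs (p m) * eta * (2 * PI - 0)) by ring.
    apply hb.
    + intros t ht. apply (variation_formula b1 b2 a b); auto; [apply hw | ].
      specialize (hsign t ht). intros heq. rewrite heq in hsign.
      rewrite Rminus_diag in hsign. lra.
    + intros t ht. rewrite Rabs_Ropp.
      replace (coefA a t * (w t - u t) * ((u t / x) ^ 2 * exp (G t)))
        with (p t * (w t - u t)) by (unfold p; ring).
      rewrite Rabs_mult.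
      apply Rmult_le_compat; try apply Rabs_pos.
      * apply hm. lra.
      * apply heta. unfold period. lra.
  - field. repeat split; lra.
Qed.

(** The multiplier decides how the return map crosses the diagonal.  If it equals
    1, the sign of H (2 pi) places the graph below the diagonal on both sides. *)
Lemma returns_near_closed b1 b2 a b x u G H :
  0 < x -> flow b1 b2 a b x u -> u (2 * PI) = x ->
  log_multiplier a u G -> curvature a u G H ->
  exists d, 0 < d /\ forall x', x' <> x -> Rabs (x' - x) < d ->
    exists w, flow b1 b2 a b x' w /\
      (0 < G (2 * PI) -> 0 < (w (2 * PI) - x') * (x' - x)) /\
      (G (2 * PI) < 0 -> (w (2 * PI) - x') * (x' - x) < 0) /\
      (G (2 * PI) = 0 -> H (2 * PI) < 0 -> w (2 * PI) < x').
Proof.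
  intros hx hu hcl hG hH.
  destruct (return_expansion b1 b2 a b x u G H hx hu hcl hG hH) as [C [hC hexp]].
  set (g := exp (G (2 * PI))) in *. set (h := H (2 * PI)) in *.
  set (q := (x * g - x + h) / x ^ 2) in *.
  assert (hg : 0 < g) by apply exp_pos.
  assert (hx2 : 0 < x ^ 2) by (apply pow_lt, hx).
  set (K := Rabs q + C + 1).
  assert (hK : 0 < K) by (unfold K; assert (hq := Rabs_pos q); lra).
  assert (hCx : 0 < 2 * x ^ 2 * (C + 1)) by nra.
  set (eta0 := if Rlt_dec h 0 then Rmin 1 (- h / (2 * x ^ 2 * (C + 1))) else 1).
  assert (heta0 : 0 < eta0 <= 1).
  { unfold eta0. destruct Rlt_dec; [ | lra]. split; [ | apply Rmin_l].
    apply Rmin_glb_lt; [lra | apply Rdiv_lt_0_compat; lra]. }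
  destruct (flow_open b1 b2 a b x u eta0 (proj1 heta0) hu) as [d1 [hd1 hd1']].
  set (d2 := if Req_EM_T g 1 then 1 else Rabs (g - 1) / K).
  assert (hd2 : 0 < d2).
  { unfold d2. destruct Req_EM_T; [lra | ]. apply Rdiv_lt_0_compat; [ | exact hK].
    apply Rabs_pos_lt. lra. }
  exists (Rmin d1 d2). split; [apply Rmin_glb_lt; lra | ].
  intros x' hne hx'.
  assert (hx'1 := Rlt_le_trans _ _ _ hx' (Rmin_l _ _)).
  assert (hx'2 := Rlt_le_trans _ _ _ hx' (Rmin_r _ _)).
  destruct (hd1' a b x') as [w [hw hwu]];
    try (rewrite Rminus_diag, Rabs_R0; lra); [lra | ].
  exists w. split; [exact hw | ].
  destruct (hexp x' w eta0 hne hw hwu) as [hsign hb].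
  set (y := w (2 * PI)) in *.
  assert (hbK : Rabs (g / (y - x) - / (x' - x)) < K).
  { replace (g / (y - x) - / (x' - x)) with (g / (y - x) - / (x' - x) + q - q) by ring.
    eapply Rle_lt_trans; [apply Rabs_triang | ]. rewrite Rabs_Ropp. unfold K. nra. }
  apply Rabs_def2 in hbK. destruct hbK as [hb1 hb2].
  assert (hd0 : x' - x <> 0) by lra.
  assert (hy0 : y - x <> 0) by nra.
  (* The product of the two displacements is positive; multiplying by it removes
     the denominators. *)
  assert (e1 : (g * (x' - x) - (y - x)) < K * ((x' - x) * (y - x))).
  { replace (g * (x' - x) - (y - x))
      with ((g / (y - x) - / (x' - x)) * ((x' - x) * (y - x))) by (field; auto).
    apply Rmult_lt_compat_r; auto. }
  assert (e2 : - K * ((x' - x) * (y - x)) < g * (x' - x) - (y - x)).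
  { replace (g * (x' - x) - (y - x))
      with ((g / (y - x) - / (x' - x)) * ((x' - x) * (y - x))) by (field; auto).
    apply Rmult_lt_compat_r; lra. }
  assert (hxx : (x' - x) ^ 2 = Rabs (x' - x) ^ 2) by (rewrite pow2_abs; reflexivity).
  split; [ | split].
  - intros hG0. assert (hg1 : 1 < g).
    { unfold g. rewrite <- exp_0. apply exp_increasing, hG0. }
    assert (hd : K * Rabs (x' - x) < g - 1).
    { unfold d2 in hx'2. destruct Req_EM_T; [lra | ].
      rewrite (Rabs_pos_eq (g - 1)) in hx'2 by lra.
      apply (Rmult_lt_compat_l K) in hx'2; [ | exact hK].
      replace (K * ((g - 1) / K)) with (g - 1) in hx'2 by (field; lra). exact hx'2. }
    destruct (Rtotal_order x' x) as [hlt | [heq | hlt]]; [ | lra | ].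
    + rewrite Rabs_left in hd by lra.
      assert (hy : y - x < 0) by nra.
      assert (hyx : y < x'); [ | nra].
      apply Rnot_le_lt. intros hle. nra.
    + rewrite Rabs_right in hd by lra.
      assert (hy : 0 < y - x) by nra.
      assert (hyx : x' < y); [ | nra].
      apply Rnot_le_lt. intros hle. nra.
  - intros hG0. assert (hg1 : g < 1).
    { unfold g. rewrite <- exp_0. apply exp_increasing, hG0. }
    assert (hd : K * Rabs (x' - x) < 1 - g).
    { unfold d2 in hx'2. destruct Req_EM_T; [lra | ].
      rewrite (Rabs_left (g - 1)) in hx'2 by lra.
      apply (Rmult_lt_compat_l K) in hx'2; [ | exact hK].
      replace (K * (- (g - 1) / K)) with (1 - g) in hx'2 by (field; lra). exact hx'2. }
    destruct (Rtotal_order x' x) as [hlt | [heq | hlt]]; [ | lra | ].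
    + rewrite Rabs_left in hd by lra.
      assert (hy : y - x < 0) by nra.
      assert (hyx : x' < y); [ | nra].
      apply Rnot_le_lt. intros hle. nra.
    + rewrite Rabs_right in hd by lra.
      assert (hy : 0 < y - x) by nra.
      assert (hyx : y < x'); [ | nra].
      apply Rnot_le_lt. intros hle. nra.
  - intros hG0 hh. assert (hg1 : g = 1) by (unfold g; rewrite hG0; apply exp_0).
    assert (hq : q = h / x ^ 2).
    { unfold q. rewrite hg1. f_equal. ring. }
    assert (hCe : C * eta0 < - q).
    { unfold eta0. destruct Rlt_dec as [hlt | hlt]; [ | lra].
      assert (hmin := Rmin_r 1 (- h / (2 * x ^ 2 * (C + 1)))).
      apply Rle_lt_trans with (C * (- h / (2 * x ^ 2 * (C + 1)))).
      - apply Rmult_le_compat_l; auto.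
      - rewrite hq. apply (Rmult_lt_reg_r (2 * x ^ 2 * (C + 1))); [exact hCx | ].
        replace (C * (- h / (2 * x ^ 2 * (C + 1))) * (2 * x ^ 2 * (C + 1))) with (C * - h)
          by (field; lra).
        replace (- (h / x ^ 2) * (2 * x ^ 2 * (C + 1))) with (2 * - h * (C + 1))
          by (field; lra).
        nra. }
    apply Rabs_le_between in hb. rewrite hg1 in hb.
    assert (hpos : 0 < 1 / (y - x) - / (x' - x)) by lra.
    assert (e3 : 0 < (x' - x) - (y - x)); [ | lra].
    replace ((x' - x) - (y - x))
      with ((1 / (y - x) - / (x' - x)) * ((x' - x) * (y - x))) by (field; auto).
    apply Rmult_lt_0_compat; auto.
Qed.

Lemma closed_singular b1 b2 a b x u G :
  0 < x -> flow b1 b2 a b x u -> u (2 * PI) = x ->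
  log_multiplier a u G -> G (2 * PI) = 0 ->
  singular_positive_closed_solution (coefA a) (coefB b b1 b2) u.
Proof.
  intros hx hu hcl hG hG0.
  assert (hu0 : u 0 = x) by apply hu.
  split.
  { split; [split | ].
    - apply sol_abel, hu.
    - rewrite hu0. exact hcl.
    - rewrite hu0. exact hx. }
  destruct (curvature_exists a u G) as [H hH]; [apply hu | exact hG | ].
  destruct (return_expansion b1 b2 a b x u G H hx hu hcl hG hH) as [C [hC hexp]].
  assert (hch : forall x', exists w, defined b1 b2 a b x' -> flow b1 b2 a b x' w).
  { intros x'. destruct (classic (defined b1 b2 a b x')) as [[w hw] | hn].
    - exists w. auto.
    - exists (fun _ => 0). intros hd. contradiction. }
  apply functional_choice in hch. destruct hch as [V hV].
  exists (fun t x' => V x' t). rewrite hu0. split.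
  - destruct (flow_open b1 b2 a b x u 1 Rlt_0_1 hu) as [d [hd hd']].
    exists (mkposreal d hd). intros x' hx'.
    change (Rabs (x' - x) < d) in hx'.
    destruct (hd' a b x') as [w [hw _]]; try (rewrite Rminus_diag, Rabs_R0; lra); [lra | ].
    assert (hVx := hV x' (ex_intro _ w hw)).
    split; [apply sol_abel, hVx | apply hVx].
  - assert (hVx : V x (2 * PI) = x).
    { rewrite (flow_unique b1 b2 a b x (V x) u (hV x (ex_intro _ u hu)) hu _ period_2PI).
      exact hcl. }
    apply is_derive_Reals. intros eps heps.
    set (q := (x * exp (G (2 * PI)) - x + H (2 * PI)) / x ^ 2) in *.
    set (K := Rabs q + C + 1).
    assert (hK : 0 < K) by (unfold K; assert (hq := Rabs_pos q); lra).
    set (eta := Rmin 1 (eps / (2 * K))).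
    assert (heta : 0 < eta <= 1).
    { unfold eta. split; [ | apply Rmin_l].
      apply Rmin_glb_lt; [lra | apply Rdiv_lt_0_compat; lra]. }
    assert (heta2 : K * eta <= eps / 2).
    { replace (eps / 2) with (K * (eps / (2 * K))) by (field; lra).
      apply Rmult_le_compat_l; [lra | apply Rmin_r]. }
    destruct (flow_open b1 b2 a b x u eta (proj1 heta) hu) as [d [hd hd']].
    exists (mkposreal d hd). intros h hh0 hh. simpl in hh.
    destruct (hd' a b (x + h)) as [w [hw hwu]]; try (rewrite Rminus_diag, Rabs_R0; lra).
    { replace (x + h - x) with h by ring. lra. }
    assert (hVw : V (x + h) (2 * PI) = w (2 * PI)).
    { apply (flow_unique b1 b2 a b (x + h)); [ | exact hw | apply period_2PI].
      apply hV. exists w. exact hw. }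
    rewrite hVw, hVx.
    destruct (hexp (x + h) w eta ltac:(lra) hw hwu) as [hs hb].
    specialize (hwu _ period_2PI). rewrite hcl in hwu.
    replace (x + h - x) with h in hs, hb by ring.
    rewrite hG0, exp_0 in hb.
    set (y := w (2 * PI)) in *.
    assert (hy0 : y - x <> 0) by nra.
    assert (hbK : Rabs (1 / (y - x) - / h) <= K).
    { replace (1 / (y - x) - / h) with (1 / (y - x) - / h + q - q) by ring.
      eapply Rle_trans; [apply Rabs_triang | ]. rewrite Rabs_Ropp.
      revert hb. unfold K, q. rewrite hG0, exp_0. intros hb. nra. }
    replace ((y - x) / h - 1) with (- ((1 / (y - x) - / h) * (y - x))) by (field; auto).
    rewrite Rabs_Ropp, Rabs_mult.
    apply Rle_lt_trans with (K * eta); [ | lra].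
    apply Rmult_le_compat; auto using Rabs_pos.
Qed.

(** * Singular solutions are strict local maxima of the displacement *)

(** The derivative of f is positive while h < 0 and negative while h > 0; as h
    increases, f goes up first and down afterwards. *)
Lemma hump (f df g h : R -> R) (p q c : R) :
  f p = c -> f q = c ->
  (forall t, p <= t <= q -> is_derive f t (df t)) ->
  (forall t, p < t < q -> df t = g t * h t) ->
  (forall t, p < t < q -> g t < 0) ->
  (forall s t, p < s -> s <= t -> t < q -> h s <= h t) ->
  forall t, p < t < q -> c <= f t.
Proof.
  intros hp hq hf hdf hg hh t ht. apply Rnot_lt_le. intros hlt.
  destruct (MVT_cor2 f df p t) as [d [hd hd']]; [lra | | ].
  { intros d hd. apply is_derive_Reals, hf. lra. }
  destruct (MVT_cor2 f df t q) as [e [he he']]; [lra | | ].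
  { intros e he. apply is_derive_Reals, hf. lra. }
  rewrite hdf in hd, he by lra.
  assert (g1 := hg d ltac:(lra)). assert (g2 := hg e ltac:(lra)).
  assert (hde := hh d e ltac:(lra) ltac:(lra) ltac:(lra)).
  assert (k1 : g d * h d < 0) by nra.
  assert (k2 : 0 < g e * h e) by nra.
  assert (k3 : 0 < h d) by nra.
  assert (k4 : h e < 0) by nra.
  lra.
Qed.

Lemma coefA_sign (a : R) :
  0 <= a -> exists tA, 0 < tA < 2 * PI /\
    (forall t, 0 < t < tA -> coefA a t < 0) /\
    (forall t, tA < t < 2 * PI -> 0 < coefA a t).
Proof.
  intros ha. assert (hpi := PI_RGT_0).
  assert (hat := atan_bound a).
  assert (hat0 : 0 <= atan a).
  { destruct ha as [ha | <-]; [ | rewrite atan_0; lra].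
    left. rewrite <- atan_0. apply atan_increasing, ha. }
  (* a sin s - cos s is a positive multiple of sin (s - th). *)
  set (th := PI / 2 - atan a).
  assert (hcos : 0 < cos (atan a)) by (apply cos_gt_0; lra).
  assert (hform : forall t, coefA a t = 2 * sin (t / 2) * (sin (t / 2 - th) / cos (atan a))).
  { intros t. rewrite coefA_half. f_equal.
    replace (t / 2 - th) with (- (PI / 2 - (t / 2 + atan a))) by (unfold th; field).
    rewrite sin_neg, sin_shift, cos_plus.
    assert (hta : a * cos (atan a) = sin (atan a)).
    { rewrite <- (tan_atan a) at 1. unfold tan. field. lra. }
    rewrite <- hta. field. lra. }
  assert (hth : 0 < th <= PI / 2) by (unfold th; lra).
  exists (2 * th). splits; try lra.
  - intros t ht. rewrite hform.
    assert (h1 := sin_half_pos t ltac:(lra)).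
    assert (h2 : sin (t / 2 - th) < 0) by (apply sin_lt_0_var; lra).
    assert (h3 : sin (t / 2 - th) / cos (atan a) < 0).
    { apply Rdiv_neg_pos; lra. }
    nra.
  - intros t ht. rewrite hform.
    assert (h1 := sin_half_pos t ltac:(lra)).
    assert (h2 : 0 < sin (t / 2 - th)) by (apply sin_gt_0; lra).
    assert (h3 : 0 < sin (t / 2 - th) / cos (atan a)) by (apply Rdiv_lt_0_compat; lra).
    nra.
Qed.

(** This is v(t, u(t)) of (C3), with the derivatives of A and B evaluated. *)
Definition v_along b1 b2 a b (u : R -> R) (t : R) : R :=
  coefB b b1 b2 t * (2 * coefA a t * u t + coefB b b1 b2 t) ^ 2
  + 4 * (coefB b b1 b2 t * (- cos t + a * sin t)
         - (b1 * cos t - b2 * sin t) * coefA a t) - coefB b b1 b2 t ^ 3.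

(** The derivative of B / (A u) along a solution is - v / (4 A^2 u). *)
Lemma ratio_mono b1 b2 a b x u p q :
  0 < x -> flow b1 b2 a b x u -> 0 <= p -> q <= 2 * PI ->
  (forall t, p < t < q -> coefA a t <> 0) ->
  (forall t, period t -> v_along b1 b2 a b u t <= 0) ->
  forall s t, p < s -> s <= t -> t < q ->
    coefB b b1 b2 s / (coefA a s * u s) <= coefB b b1 b2 t / (coefA a t * u t).
Proof.
  intros hx hu hp hq hA hv s t hs hst ht.
  assert (hpos := flow_pos _ _ _ _ _ _ hx hu).
  destruct hu as [[_ hu] _].
  apply (derive_mono (fun r => coefB b b1 b2 r / (coefA a r * u r))
    (fun r => - v_along b1 b2 a b u r / (4 * coefA a r ^ 2 * u r))); auto.
  - intros r hr. assert (hpr : period r) by (unfold period; lra).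
    specialize (hu r hpr). specialize (hpos r hpr). specialize (hA r ltac:(lra)).
    assert (dA := coefA_derive a r). assert (dB := coefB_derive b b1 b2 r).
    set (fA := coefA a) in *. set (fB := coefB b b1 b2) in *.
    auto_derive.
    + repeat split; try (eexists; eassumption).
      apply Rmult_integral_contrapositive_currified; lra.
    + derive_rewrite. unfold v_along. fold fA fB. field. split; lra.
  - intros r hr. assert (hpr : period r) by (unfold period; lra).
    specialize (hpos r hpr). specialize (hA r ltac:(lra)). specialize (hv r hpr).
    apply Rdiv_le_0_compat; [lra | ].
    apply Rmult_lt_0_compat; [ | exact hpos].
    assert (h := pow2_gt_0 _ hA). lra.
Qed.

Lemma weighted_decrease (W g D : R -> R) (d tA T : R) :
  0 < d <= tA -> tA <= T ->
  (forall t, 0 <= t <= T -> is_derive W t (g t * D t)) ->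
  (forall t, 0 < t < tA -> g t < 0) -> (forall t, tA < t < T -> 0 < g t) ->
  (forall t, 0 < t < d -> 0 < D t) -> (forall t, 0 < t < tA -> 0 <= D t) ->
  (forall t, tA < t < T -> D t <= 0) ->
  W T < W 0.
Proof.
  intros hd hT hW hg1 hg2 hD0 hD1 hD2.
  assert (dW : forall t, 0 <= t <= T -> is_derive (fun t => - W t) t (- (g t * D t))).
  { intros t ht. apply (is_derive_opp (V := R_NormedModule)). auto. }
  assert (w1 : - W 0 < - W d).
  { apply (derive_mono_strict (fun t => - W t) (fun t => - (g t * D t))); [lra | | ].
    - intros t ht. apply dW. lra.
    - intros t ht. specialize (hg1 t ltac:(lra)). specialize (hD0 t ltac:(lra)). nra. }
  assert (w2 : - W d <= - W tA).
  { apply (derive_mono (fun t => - W t) (fun t => - (g t * D t))); [lra | | ].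
    - intros t ht. apply dW. lra.
    - intros t ht. specialize (hg1 t ltac:(lra)). specialize (hD1 t ltac:(lra)). nra. }
  assert (w3 : - W tA <= - W T).
  { apply (derive_mono (fun t => - W t) (fun t => - (g t * D t))); [lra | | ].
    - intros t ht. apply dW. lra.
    - intros t ht. specialize (hg2 t ltac:(lra)). specialize (hD2 t ltac:(lra)). nra. }
  lra.
Qed.

(** The exponent kappa makes ln u - kappa G equal to ln x at 0, tA and 2 pi.  The
    strict inequality near t = 0 comes from B(0) > 0. *)
Lemma singular_comparison b1 b2 a b x u G :
  0 < x -> 0 <= a -> 0 < b + b2 -> flow b1 b2 a b x u -> u (2 * PI) = x ->
  log_multiplier a u G -> G (2 * PI) = 0 ->
  (forall t, period t -> v_along b1 b2 a b u t <= 0) ->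
  exists kappa tA d, 0 < d <= tA /\ tA < 2 * PI /\
    (forall t, 0 < t < tA -> coefA a t < 0) /\
    (forall t, tA < t < 2 * PI -> 0 < coefA a t) /\
    (forall t, 0 < t < d -> x * exp (kappa * G t) < u t) /\
    (forall t, 0 < t < tA -> x * exp (kappa * G t) <= u t) /\
    (forall t, tA < t < 2 * PI -> u t <= x * exp (kappa * G t)).
Proof.
  intros hx ha hB0 hu hcl [hG0 hG] hG1 hv. assert (hpi := PI_RGT_0).
  assert (hpos := flow_pos _ _ _ _ _ _ hx hu).
  destruct (coefA_sign a ha) as [tA [htA [hA1 hA2]]].
  assert (hGA : G tA < 0).
  { assert (h := derive_mono_strict (fun t => - G t) (fun t => - (coefA a t * u t ^ 2)) 0 tA
      ltac:(lra)). cbv beta in h. rewrite hG0 in h.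
    cut (- 0 < - G tA); [lra | ]. apply h.
    - intros t ht. apply (is_derive_opp (V := R_NormedModule)), hG.
    - intros t ht. specialize (hA1 t ht).
      assert (hp := pow_lt _ 2 (hpos t ltac:(unfold period; lra))). nra. }
  assert (hpA := hpos tA ltac:(unfold period; lra)).
  set (kappa := ln (u tA / x) / G tA).
  set (L := fun t => ln (u t) - kappa * G t).
  assert (hu0 : u 0 = x) by apply hu.
  assert (hL0 : L 0 = ln x) by (unfold L; rewrite hu0, hG0; ring).
  assert (hLA : L tA = ln x).
  { unfold L, kappa. rewrite ln_div by lra. field. lra. }
  assert (hL1 : L (2 * PI) = ln x) by (unfold L; rewrite hcl, hG1; ring).
  assert (hdL : forall t, period t -> is_derive L t
     (u t * (coefB b b1 b2 t + (1 - kappa) * coefA a t * u t))).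
  { intros t ht. assert (hp := hpos t ht). assert (hd := proj2 (proj1 hu) t ht).
    assert (hg := hG t). unfold L. auto_derive.
    - repeat split; try (eexists; eassumption). exact hp.
    - derive_rewrite. field. lra. }
  (* A u^2 rho is the derivative of L, and rho is increasing by the sign of v. *)
  set (rho := fun t => coefB b b1 b2 t / (coefA a t * u t) + (1 - kappa)).
  assert (hdL' : forall t, 0 < t < 2 * PI -> coefA a t <> 0 ->
     u t * (coefB b b1 b2 t + (1 - kappa) * coefA a t * u t)
     = coefA a t * u t ^ 2 * rho t).
  { intros t ht hA. specialize (hpos t ltac:(unfold period; lra)).
    unfold rho. field. split; lra. }
  assert (hrho : forall p q, 0 <= p -> q <= 2 * PI ->
     (forall t, p < t < q -> coefA a t <> 0) ->
     forall s t, p < s -> s <= t -> t < q -> rho s <= rho t).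
  { intros p q hp hq hA s t h1 h2 h3. unfold rho. apply Rplus_le_compat_r.
    apply (ratio_mono b1 b2 a b x u p q hx hu hp hq hA hv s t h1 h2 h3). }
  assert (hu2 : forall t, 0 < t < 2 * PI -> 0 < u t ^ 2).
  { intros t ht. apply pow_lt, hpos. unfold period; lra. }
  assert (hL_ge : forall t, 0 < t < tA -> ln x <= L t).
  { apply (hump L (fun t => u t * (coefB b b1 b2 t + (1 - kappa) * coefA a t * u t))
      (fun t => coefA a t * u t ^ 2) rho 0 tA (ln x) hL0 hLA).
    - intros t ht. apply hdL. unfold period; lra.
    - intros t ht. apply hdL'; [lra | apply Rlt_not_eq, hA1, ht].
    - intros t ht. assert (h1 := hA1 t ht). assert (h2 := hu2 t ltac:(lra)). nra.
    - apply hrho; [lra | lra | ]. intros t ht. apply Rlt_not_eq, hA1, ht. }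
  assert (hL_le : forall t, tA < t < 2 * PI -> L t <= ln x).
  { intros t ht. apply Ropp_le_cancel. revert t ht.
    apply (hump (fun t => - L t)
      (fun t => - (u t * (coefB b b1 b2 t + (1 - kappa) * coefA a t * u t)))
      (fun t => - (coefA a t * u t ^ 2)) rho); [rewrite hLA; reflexivity | | | | | ].
    - rewrite hL1. reflexivity.
    - intros t ht. apply (is_derive_opp (V := R_NormedModule)), hdL. unfold period; lra.
    - intros t ht. rewrite hdL'; [ring | lra | apply Rgt_not_eq, hA2, ht].
    - intros t ht. assert (h1 := hA2 t ht). assert (h2 := hu2 t ltac:(lra)). nra.
    - apply hrho; [lra | lra | ]. intros t ht. apply Rgt_not_eq, hA2, ht. }
  assert (hexp : forall t, period t -> u t = exp (L t) * exp (kappa * G t)).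
  { intros t ht. rewrite <- exp_plus. unfold L.
    replace (ln (u t) - kappa * G t + kappa * G t) with (ln (u t)) by ring.
    symmetry. apply exp_ln, hpos, ht. }
  assert (hxe : x = exp (ln x)) by (symmetry; apply exp_ln, hx).
  assert (hexple : forall r s, r <= s -> exp r <= exp s).
  { intros r s [hlt | ->]; [left; apply exp_increasing, hlt | lra]. }
  set (dL := fun t => u t * (coefB b b1 b2 t + (1 - kappa) * coefA a t * u t)).
  assert (cdL : continuous dL 0).
  { assert (cA := coefA_continuous a). assert (cB := coefB_continuous b b1 b2).
    assert (cu := proj1 (proj1 hu)). unfold dL. continuity_auto. }
  assert (hdL0 : 0 < dL 0).
  { unfold dL. rewrite hu0. unfold coefA, coefB. rewrite sin_0, cos_0. nra. }
  destruct (eps_of_continuous dL 0 cdL (dL 0) hdL0) as [d [hd hd']].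
  exists kappa, tA, (Rmin d tA). splits; try lra; auto.
  - apply Rmin_glb_lt; lra.
  - apply Rmin_r.
  - intros t ht.
    assert (ht1 := Rlt_le_trans _ _ _ (proj2 ht) (Rmin_l _ _)).
    assert (ht2 := Rlt_le_trans _ _ _ (proj2 ht) (Rmin_r _ _)).
    assert (hlt : L 0 < L t).
    { apply (derive_mono_strict L dL); [lra | | ].
      - intros s hs. apply hdL. unfold period; lra.
      - intros s hs. assert (h := hd' s).
        rewrite Rminus_0_r, Rabs_right in h by lra.
        specialize (h ltac:(lra)). apply Rabs_def2 in h. lra. }
    rewrite (hexp t) by (unfold period; lra).
    apply Rmult_lt_compat_r; [apply exp_pos | ].
    rewrite hxe, <- hL0. apply exp_increasing, hlt.
  - intros t ht. rewrite (hexp t) by (unfold period; lra).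
    apply Rmult_le_compat_r; [left; apply exp_pos | ].
    rewrite hxe at 1. apply hexple.
    apply hL_ge, ht.
  - intros t ht. rewrite (hexp t) by (unfold period; lra).
    apply Rmult_le_compat_r; [left; apply exp_pos | ].
    rewrite hxe. apply hexple.
    apply hL_le, ht.
Qed.

(** Compares H with the integral of x e^(kappa G) A u^2 e^G, which is zero because
    it is the variation of a function of G and G(2 pi) = G(0). *)
Lemma singular_curvature_neg b1 b2 a b x u G H :
  0 < x -> 0 <= a -> 0 < b + b2 -> flow b1 b2 a b x u -> u (2 * PI) = x ->
  log_multiplier a u G -> G (2 * PI) = 0 -> curvature a u G H ->
  (forall t, period t -> v_along b1 b2 a b u t <= 0) ->
  H (2 * PI) < 0.
Proof.
  intros hx ha hB0 hu hcl hG hG1 [hH0 hH] hv.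
  destruct (singular_comparison b1 b2 a b x u G hx ha hB0 hu hcl hG hG1 hv)
    as [kappa [tA [d [hd [htA [hA1 [hA2 [hu1 [hu2 hu3]]]]]]]]].
  destruct hG as [hG0 hG].
  assert (hpos := flow_pos _ _ _ _ _ _ hx hu).
  destruct (primitive (fun s => x * exp ((kappa + 1) * s))) as [Psi [_ hPsi]].
  { intros s. apply (derive_continuous (fun s => x * exp ((kappa + 1) * s)) s
      (x * ((kappa + 1) * exp ((kappa + 1) * s)))). auto_derive; [auto | ring]. }
  assert (h := weighted_decrease (fun t => H t - Psi (G t))
    (fun t => coefA a t * u t ^ 2 * exp (G t))
    (fun t => u t - x * exp (kappa * G t)) d tA (2 * PI) hd (Rlt_le _ _ htA)).
  cbv beta in h. rewrite hG1, hG0, hH0 in h.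
  cut (H (2 * PI) - Psi 0 < 0 - Psi 0); [lra | ].
  assert (hw : forall t, period t -> 0 < u t ^ 2 * exp (G t)).
  { intros t ht. apply Rmult_lt_0_compat; [apply pow_lt, hpos, ht | apply exp_pos]. }
  apply h.
  - intros t ht. specialize (hH t). specialize (hPsi (G t)). specialize (hG t).
    evar_last.
    + apply (is_derive_minus (V := R_NormedModule)); [exact hH | ].
      apply (is_derive_comp Psi G); [exact hPsi | exact hG].
    + unfold minus, plus, opp, scal; simpl; unfold mult; simpl.
      replace ((kappa + 1) * G t) with (kappa * G t + G t) by ring.
      rewrite exp_plus. ring.
  - intros t ht. specialize (hA1 t ht). specialize (hw t ltac:(unfold period; lra)).
    rewrite Rmult_assoc. nra.
  - intros t ht. specialize (hA2 t ht). specialize (hw t ltac:(unfold period; lra)).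
    rewrite Rmult_assoc. nra.
  - intros t ht. specialize (hu1 t ht). lra.
  - intros t ht. specialize (hu2 t ht). lra.
  - intros t ht. specialize (hu3 t ht). lra.
Qed.

(** The integral of A u over the period is - 2 pi b, from integrating (1 / u)'.  It
    is compared with the vanishing integral of A u^2 / (x e^(kappa G)).  The
    weak inequality v <= 0 is what passes to limits of singular solutions. *)
Lemma singular_b_neg b1 b2 a b x u G :
  0 < x -> 0 <= a -> 0 < b + b2 -> flow b1 b2 a b x u -> u (2 * PI) = x ->
  log_multiplier a u G -> G (2 * PI) = 0 ->
  (forall t, period t -> v_along b1 b2 a b u t <= 0) ->
  b < 0.
Proof.
  intros hx ha hB0 hu hcl hG hG1 hv. assert (hpi := PI_RGT_0).
  destruct (singular_comparison b1 b2 a b x u G hx ha hB0 hu hcl hG hG1 hv)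
    as [kappa [tA [d [hd [htA [hA1 [hA2 [hu1 [hu2 hu3]]]]]]]]].
  destruct hG as [hG0 hG].
  assert (hpos := flow_pos _ _ _ _ _ _ hx hu).
  destruct (primitive (fun s => exp (- (kappa * s)) / x)) as [Psi [_ hPsi]].
  { intros s. apply (derive_continuous (fun s => exp (- (kappa * s)) / x) s
      (- kappa * exp (- (kappa * s)) / x)). auto_derive; [lra | field; lra]. }
  assert (h := weighted_decrease
    (fun t => Psi (G t) + / u t + (b * t - b1 * cos t + b2 * sin t))
    (fun t => coefA a t * u t ^ 2)
    (fun t => / (x * exp (kappa * G t)) - / u t) d tA (2 * PI) hd (Rlt_le _ _ htA)).
  cbv beta in h. rewrite hG1, hG0, hcl in h.
  replace (u 0) with x in h by (symmetry; apply hu).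
  rewrite cos_2PI, sin_2PI, cos_0, sin_0 in h.
  assert (hfin : Psi 0 + / x + (b * (2 * PI) - b1 * 1 + b2 * 0)
                 < Psi 0 + / x + (b * 0 - b1 * 1 + b2 * 0)); [apply h | nra].
  - intros t ht. specialize (hPsi (G t)). specialize (hG t).
    specialize (hpos t ht).
    assert (dinv := flow_inv_derive b1 b2 a b x u t hx hu ht).
    evar_last.
    + apply (is_derive_plus (V := R_NormedModule)).
      * apply (is_derive_plus (V := R_NormedModule)); [ | exact dinv].
        apply (is_derive_comp Psi G); [exact hPsi | exact hG].
      * instantiate (1 := coefB b b1 b2 t). unfold coefB.
        auto_derive; [auto | ring].
    + unfold plus, scal; simpl; unfold mult; simpl.
      assert (hE := exp_pos (kappa * G t)).
      rewrite exp_Ropp. field. lra.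
  - intros t ht. specialize (hA1 t ht).
    assert (hw := pow_lt _ 2 (hpos t ltac:(unfold period; lra))). nra.
  - intros t ht. specialize (hA2 t ht).
    assert (hw := pow_lt _ 2 (hpos t ltac:(unfold period; lra))). nra.
  - intros t ht. specialize (hu1 t ht). assert (hE := exp_pos (kappa * G t)).
    assert (hm : 0 < x * exp (kappa * G t)) by (apply Rmult_lt_0_compat; lra).
    assert (hmu : 0 < x * exp (kappa * G t) * u t) by (apply Rmult_lt_0_compat; lra).
    assert (hi := Rinv_lt_contravar _ _ hmu hu1). lra.
  - intros t ht. specialize (hu2 t ht). assert (hE := exp_pos (kappa * G t)).
    assert (hm : 0 < x * exp (kappa * G t)) by (apply Rmult_lt_0_compat; lra).
    assert (hi := Rinv_le_contravar _ _ hm hu2). lra.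
  - intros t ht. specialize (hu3 t ht).
    assert (hi := Rinv_le_contravar _ _ (hpos t ltac:(unfold period; lra)) hu3). lra.
Qed.

(** * Closed solutions near infinity and singular solutions near b0 = 0 *)

(** On a closed solution - G (2 pi) is the integral of B u.  Near both ends B > 0,
    and the contribution near t = 0 grows like ln x; in the middle u is bounded
    independently of x. *)
Lemma large_closed_contracting b1 b2 a1 b0 :
  0 <= a1 -> b0 <= 0 -> 0 < b0 + b2 ->
  exists X, 0 < X /\ forall a b x u G,
    0 <= a <= a1 -> b0 <= b <= 0 -> X <= x ->
    flow b1 b2 a b x u -> u (2 * PI) = x -> log_multiplier a u G -> G (2 * PI) < 0.
Proof.
  intros ha1 hb0 hB. assert (hpi := PI_RGT_0).
  (* |b0| dominates |b| for all b in [b0, 0], so S serves all parameters at once. *)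
  set (S := Rabs b0 + Rabs b1 + Rabs b2).
  assert (hS : 0 <= S).
  { unfold S. assert (h1 := Rabs_pos b0). assert (h2 := Rabs_pos b1).
    assert (h3 := Rabs_pos b2). lra. }
  set (L := inverse_speed a1 S). assert (hL : 0 < L) by (apply inverse_speed_pos; lra).
  set (beta := (b0 + b2) / 2). assert (hbeta : 0 < beta) by (unfold beta; lra).
  destruct (eps_of_continuous _ 0 (coefB_continuous b0 b1 b2 0) beta hbeta) as [d0 [hd0 hd0']].
  assert (hB00 : coefB b0 b1 b2 0 = b0 + b2).
  { unfold coefB. rewrite sin_0, cos_0. ring. }
  rewrite hB00 in hd0'.
  set (d := Rmin (d0 / 2) (PI / 2)).
  assert (hd : 0 < d) by (unfold d; apply Rmin_glb_lt; lra).
  assert (hd1 : d <= d0 / 2) by apply Rmin_l.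
  assert (hd2 : d <= PI / 2) by apply Rmin_r.
  assert (hend : forall t, Rabs t <= d -> beta <= coefB b0 b1 b2 t).
  { intros t ht. assert (h := hd0' t). rewrite Rminus_0_r in h.
    specialize (h ltac:(lra)). apply Rabs_def2 in h. unfold beta in *. lra. }
  destruct (sin_half_lower d hd) as [c [hc hc']].
  set (m := S * ((1 + 2 * S) / c)).
  assert (hm : 0 <= m).
  { unfold m. apply Rmult_le_pos; [lra | ]. apply Rdiv_le_0_compat; lra. }
  set (q := 2 * PI * m * L / beta - ln (L * d)).
  exists (exp (q + 1)). split; [apply exp_pos | ].
  intros a b x u G ha hb hX hu hcl [hG0 hG].
  assert (hx : 0 < x) by (assert (h := exp_pos (q + 1)); lra).
  assert (hlnx : q < ln x).
  { assert (h : q + 1 <= ln x); [ | lra].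
    rewrite <- (ln_exp (q + 1)). apply ln_le; [apply exp_pos | exact hX]. }
  assert (hbS : Rabs b + Rabs b1 + Rabs b2 <= S).
  { unfold S. rewrite (Rabs_left1 b), (Rabs_left1 b0) by lra. lra. }
  assert (hpos := flow_pos _ _ _ _ _ _ hx hu).
  assert (hBb : forall t, coefB b0 b1 b2 t <= coefB b b1 b2 t) by (intros t; unfold coefB; lra).
  set (T := fun t => ln (u t) - G t).
  assert (hT : forall t, period t -> is_derive T t (coefB b b1 b2 t * u t)).
  { intros t ht. specialize (hpos t ht). assert (hd' := proj2 (proj1 hu) t ht).
    specialize (hG t). unfold T. auto_derive.
    - repeat split; try (eexists; eassumption). exact hpos.
    - derive_rewrite. field. lra. }
  assert (hu0 : u 0 = x) by apply hu.
  (* Near the start, u is at least 1 / (1 / x + L t), whose integral grows like ln x. *)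
  assert (s1 : beta / L * (ln (L * d) + ln x) <= T d - T 0).
  { assert (h := derive_mono (fun t => T t - beta / L * ln (/ x + L * t))
      (fun t => coefB b b1 b2 t * u t - beta / (/ x + L * t)) 0 d ltac:(lra)).
    cbv beta in h.
    assert (hxi : 0 < / x) by (apply Rinv_0_lt_compat, hx).
    assert (h' : T 0 - beta / L * ln (/ x + L * 0) <= T d - beta / L * ln (/ x + L * d)).
    { apply h.
      - intros t ht. assert (hp : period t) by (unfold period; lra).
        specialize (hT t hp). assert (0 < / x + L * t) by nra.
        auto_derive.
        + repeat split; try (eexists; eassumption); lra.
        + derive_rewrite. assert (0 <= x * (L * t)) by (repeat apply Rmult_le_pos; lra).
          field. lra.
      - intros t ht. assert (hp : period t) by (unfold period; lra).
        assert (hlip := flow_inv_lipschitz b1 b2 a a1 b x S u 0 t hx hu (Rle_refl 0)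
          ltac:(lra) ltac:(lra) ha hbS). fold L in hlip.
        rewrite hu0, Rminus_0_r in hlip. apply Rabs_le_between in hlip.
        specialize (hpos t hp).
        assert (hbt := hend t ltac:(rewrite Rabs_right; lra)). specialize (hBb t).
        assert (hlow : / (/ x + L * t) <= u t).
        { rewrite <- (Rinv_inv (u t)). apply Rinv_le_contravar; [ | lra].
          apply Rinv_0_lt_compat, hpos. }
        unfold Rdiv. nra. }
    rewrite Rmult_0_r, Rplus_0_r, ln_Rinv in h' by exact hx.
    assert (hmono : ln (L * d) <= ln (/ x + L * d)) by (apply ln_le; nra).
    assert (hbl : 0 < beta / L) by (apply Rdiv_lt_0_compat; lra).
    nra. }
  assert (s2 : - (m * (2 * PI)) <= T (2 * PI - d) - T d).
  { assert (h := derive_mono (fun t => T t + m * t)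
      (fun t => coefB b b1 b2 t * u t + m) d (2 * PI - d) ltac:(lra)).
    cbv beta in h.
    assert (h' : T d + m * d <= T (2 * PI - d) + m * (2 * PI - d)); [ | nra].
    apply h.
    - intros t ht. assert (hp : period t) by (unfold period; lra).
      specialize (hT t hp). auto_derive; [eexists; exact hT | ]. derive_rewrite. ring.
    - intros t ht. assert (hp : period t) by (unfold period; lra).
      assert (hub := sol_sin_half_bound b1 b2 a b x S u hbS ltac:(lra) hu t hp).
      specialize (hc' t ltac:(lra)). specialize (hpos t hp).
      assert (hut : u t <= (1 + 2 * S) / c).
      { apply (Rmult_le_reg_r c); [exact hc | ].
        replace ((1 + 2 * S) / c * c) with (1 + 2 * S) by (field; lra). nra. }
      assert (hBt : Rabs (coefB b b1 b2 t * u t) <= m).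
      { rewrite Rabs_mult. unfold m. apply Rmult_le_compat; try apply Rabs_pos.
        - eapply Rle_trans; [apply coefB_bound | exact hbS].
        - rewrite Rabs_right; lra. }
      apply Rabs_le_between in hBt. lra. }
  assert (s3 : T (2 * PI - d) <= T (2 * PI)).
  { apply (derive_mono T (fun t => coefB b b1 b2 t * u t)); [lra | | ].
    - intros t ht. apply hT. unfold period; lra.
    - intros t ht. specialize (hpos t ltac:(unfold period; lra)).
      assert (hper : coefB b0 b1 b2 t = coefB b0 b1 b2 (t - 2 * PI)).
      { unfold coefB. rewrite sin_minus, cos_minus, sin_2PI, cos_2PI. ring. }
      assert (h := hend (t - 2 * PI) ltac:(rewrite Rabs_left; lra)).
      specialize (hBb t). nra. }
  assert (hsum : T (2 * PI) - T 0 = - G (2 * PI)).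
  { unfold T. rewrite hcl, hu0, hG0. ring. }
  assert (hq : m * (2 * PI) < beta / L * (ln (L * d) + ln x)).
  { assert (hbl : 0 < beta / L) by (apply Rdiv_lt_0_compat; lra).
    replace (m * (2 * PI)) with (beta / L * (ln (L * d) + q)).
    - apply Rmult_lt_compat_l; lra.
    - unfold q. field. lra. }
  lra.
Qed.

Definition singular_data b1 b2 a b x (u G : R -> R) : Prop :=
  flow b1 b2 a b x u /\ u (2 * PI) = x /\ log_multiplier a u G /\ G (2 * PI) = 0.

Definition singular_v_neg b1 b2 a b x : Prop :=
  exists u G, singular_data b1 b2 a b x u G /\
    forall t, period t -> v_along b1 b2 a b u t < 0.

Lemma is_lim_seq_of_bound (f : nat -> R) (l : R) :
  (forall n, Rabs (f n - l) <= / (INR n + 1)) -> is_lim_seq f l.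
Proof.
  intros hf. apply is_lim_seq_spec. intros eps.
  destruct (archimed_cor1 eps (cond_pos eps)) as [N [hN hN0]].
  exists N. intros n hn. eapply Rle_lt_trans; [apply hf | ].
  eapply Rle_lt_trans; [ | exact hN].
  apply Rinv_le_contravar; [apply lt_0_INR, hN0 | ].
  apply le_INR in hn. lra.
Qed.

Lemma is_lim_seq_pow (f : nat -> R) (l : R) (k : nat) :
  is_lim_seq f l -> is_lim_seq (fun n => f n ^ k) (l ^ k).
Proof.
  intros hf. induction k as [ | k IH]; simpl.
  - apply is_lim_seq_const.
  - apply is_lim_seq_mult'; assumption.
Qed.

Ltac lim_seq_auto :=
  lazymatch goal with
  | |- is_lim_seq (fun n => _ + _) _ => apply is_lim_seq_plus'; lim_seq_auto
  | |- is_lim_seq (fun n => _ - _) _ => apply is_lim_seq_minus'; lim_seq_auto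
  | |- is_lim_seq (fun n => _ * _) _ => apply is_lim_seq_mult'; lim_seq_auto
  | |- is_lim_seq (fun n => _ ^ _) _ => apply is_lim_seq_pow; lim_seq_auto
  | |- _ => first [ assumption | apply is_lim_seq_const ]
  end.

(** A limit of such solutions would be a singular solution with b = 0 and v <= 0,
    against singular_b_neg. *)
Lemma singular_not_near_b_zero b1 b2 a x :
  0 <= a -> 0 < x -> 0 < b2 ->
  exists d, 0 < d /\ forall a' b' x', 0 <= a' -> 0 <= x' ->
    Rabs (a' - a) <= d -> Rabs b' <= d -> Rabs (x' - x) <= d ->
    ~ singular_v_neg b1 b2 a' b' x'.
Proof.
  intros ha hx hb2. apply NNPP. intros hno. assert (hpi := PI_RGT_0).
  destruct (returns_le_limit b1 b2 a 0 x
    (fun a' b' x' w => w (2 * PI) = x' /\ exists G, log_multiplier a' w G /\ G (2 * PI) = 0 /\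
       forall t, period t -> v_along b1 b2 a' b' w t < 0) ha ltac:(lra)) as [u [hu happ]].
  { intros d hd. apply NNPP. intros hn. apply hno. exists d. split; [exact hd | ].
    intros a' b' x' h1 h2 h3 h4 h5 [w [G [[k1 [k2 [k3 k4]]] k5]]].
    apply hn. exists a', b', x', w. splits; auto.
    - rewrite Rminus_0_r. exact h4.
    - lra.
    - exists G. auto. }
  assert (hsmall : forall z C, (forall eta, 0 < eta <= 1 -> Rabs z <= C * eta) -> z = 0).
  { intros z C hz. destruct (Req_dec z 0) as [h0 | h0]; [exact h0 | exfalso].
    assert (hzp := Rabs_pos_lt z h0).
    assert (hC : 0 < C) by (specialize (hz 1 ltac:(lra)); lra).
    set (eta := Rmin 1 (Rabs z / (2 * C))).
    assert (heta : 0 < eta <= 1).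
    { unfold eta. split; [ | apply Rmin_l].
      apply Rmin_glb_lt; [lra | apply Rdiv_lt_0_compat; lra]. }
    specialize (hz eta heta).
    assert (h : C * eta <= Rabs z / 2); [ | lra].
    replace (Rabs z / 2) with (C * (Rabs z / (2 * C))) by (field; lra).
    apply Rmult_le_compat_l; [lra | apply Rmin_r]. }
  assert (hcl : u (2 * PI) = x).
  { apply Rminus_diag_uniq. apply (hsmall _ 2). intros eta heta.
    destruct (happ eta (proj1 heta)) as [a' [b' [x' [w [_ [_ [q3 [_ [_ [[q6 _] q7]]]]]]]]]].
    specialize (q7 _ period_2PI). rewrite q6 in q7.
    apply Rabs_le_between in q3. apply Rabs_le_between in q7. apply Rabs_le. lra. }
  destruct (log_multiplier_exists a u (proj1 (proj1 hu))) as [G hG].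
  assert (hG1 : G (2 * PI) = 0).
  { destruct (flow_bound_exists _ _ _ _ _ _ hu) as [M [hM hM']].
    apply (hsmall _ ((2 * (M + 1) ^ 2 + (1 + 2 * a) * (2 * M + 1)) * (2 * PI))).
    intros eta heta.
    destruct (happ eta (proj1 heta))
      as [a' [b' [x' [w [q1 [_ [_ [_ [_ [[_ [G' [hG' [hG'1 _]]]] q7]]]]]]]]]].
    assert (h := derive_bound (fun t => G t - G' t)
      (fun t => coefA a t * u t ^ 2 - coefA a' t * w t ^ 2) 0 (2 * PI)
      ((2 * (M + 1) ^ 2 + (1 + 2 * a) * (2 * M + 1)) * eta) ltac:(lra)).
    cbv beta in h. rewrite (proj1 hG), (proj1 hG'), hG'1 in h.
    rewrite !Rminus_0_r in h.
    replace ((2 * (M + 1) ^ 2 + (1 + 2 * a) * (2 * M + 1)) * (2 * PI) * eta)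
      with ((2 * (M + 1) ^ 2 + (1 + 2 * a) * (2 * M + 1)) * eta * (2 * PI)) by ring.
    apply h.
    - intros t ht. apply (is_derive_minus (V := R_NormedModule)); [apply hG | apply hG'].
    - intros t ht. specialize (q7 t ltac:(unfold period; lra)).
      specialize (hM' t ltac:(unfold period; lra)).
      replace (coefA a t * u t ^ 2 - coefA a' t * w t ^ 2)
        with (- ((coefA a' t - coefA a t) * (w t * w t))
              - coefA a t * ((w t - u t) * (w t + u t))) by ring.
      eapply Rle_trans; [apply Rabs_triang | ]. rewrite !Rabs_Ropp.
      assert (hw : Rabs (w t) <= M + 1).
      { replace (w t) with ((w t - u t) + u t) by ring.
        eapply Rle_trans; [apply Rabs_triang | lra]. }
      rewrite Rmult_plus_distr_r. apply Rplus_le_compat.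
      + rewrite !Rabs_mult.
        replace (2 * (M + 1) ^ 2 * eta) with (2 * eta * ((M + 1) * (M + 1))) by ring.
        apply Rmult_le_compat; try apply Rabs_pos.
        * apply Rmult_le_pos; apply Rabs_pos.
        * eapply Rle_trans; [apply coefA_dist | lra].
        * apply Rmult_le_compat; auto using Rabs_pos.
      + rewrite !Rabs_mult.
        replace ((1 + 2 * a) * (2 * M + 1) * eta) with ((1 + 2 * a) * (eta * (2 * M + 1))) by ring.
        apply Rmult_le_compat; try apply Rabs_pos.
        * apply Rmult_le_pos; apply Rabs_pos.
        * eapply Rle_trans; [apply coefA_bound | ]. rewrite (Rabs_right a); lra.
        * apply Rmult_le_compat; auto using Rabs_pos.
          eapply Rle_trans; [apply Rabs_triang | lra]. }
  assert (hv : forall t, period t -> v_along b1 b2 a 0 u t <= 0).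
  { intros t ht.
    assert (hseq : forall n, exists p : (R * R) * R,
      Rabs (fst (fst p) - a) <= / (INR n + 1) /\ Rabs (snd (fst p) - 0) <= / (INR n + 1) /\
      Rabs (snd p - u t) <= / (INR n + 1) /\
      v_along b1 b2 (fst (fst p)) (snd (fst p)) (fun _ => snd p) t < 0).
    { intros n.
      destruct (happ (/ (INR n + 1)))
        as [a' [b' [x' [w [q1 [q2 [_ [_ [_ [[_ [_ [_ [_ q6]]]] q7]]]]]]]]]].
      { apply Rinv_0_lt_compat. assert (h := pos_INR n). lra. }
      exists ((a', b'), w t). simpl. splits; auto. apply (q6 t ht). }
    apply functional_choice in hseq. destruct hseq as [p hp].
    assert (l1 : is_lim_seq (fun n => fst (fst (p n))) a)
      by (apply is_lim_seq_of_bound; intros n; apply hp).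
    assert (l2 : is_lim_seq (fun n => snd (fst (p n))) 0)
      by (apply is_lim_seq_of_bound; intros n; apply hp).
    assert (l3 : is_lim_seq (fun n => snd (p n)) (u t))
      by (apply is_lim_seq_of_bound; intros n; apply hp).
    change (Rbar_le (v_along b1 b2 a 0 u t) 0).
    apply (is_lim_seq_le
      (fun n => v_along b1 b2 (fst (fst (p n))) (snd (fst (p n))) (fun _ => snd (p n)) t)
      (fun _ => 0)).
    - intros n. left. apply hp.
    - unfold v_along, coefA, coefB.
      lim_seq_auto.
    - apply is_lim_seq_const. }
  assert (h := singular_b_neg b1 b2 a 0 x u G hx ha ltac:(lra) hu hcl hG hG1 hv). lra.
Qed.

(** * The two extremal arguments *)

(** Existence up to time 2 pi is obtained by continuation in the initial value,
    starting from the zero solution. *)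
Lemma a0_zero_returns_lt b1 b2 b x :
  0 <= b2 -> b < 0 -> 0 < x -> returns_lt b1 b2 0 b x.
Proof.
  intros hb2 hb hx.
  assert (hle : returns_le b1 b2 0 b (1 * x)).
  { apply (continuation b1 b2 (fun _ => 0) (fun _ => b) (fun s => s * x));
      try (intros s; continuity_auto).
    - intros; lra.
    - intros s hs. nra.
    - exists (fun _ => 0). split; [apply sol_zero | ring].
    - intros s u hs hu. destruct (Req_dec s 0) as [-> | hs0].
      + assert (hz : flow b1 b2 0 b (0 * x) (fun _ => 0)) by (split; [apply sol_zero | ring]).
        rewrite (flow_unique _ _ _ _ _ _ _ hu hz _ period_2PI). lra.
      + left. apply (a0_zero_decreases b1 b2 b (s * x) u); auto.
        apply Rmult_lt_0_compat; lra. }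
  rewrite Rmult_1_l in hle. destruct hle as [u [hu _]].
  exists u. split; [exact hu | ]. apply (a0_zero_decreases b1 b2 b x u); auto.
Qed.

Lemma closed_not_returns_lt b1 b2 a b x u :
  flow b1 b2 a b x u -> u (2 * PI) = x -> ~ returns_lt b1 b2 a b x.
Proof.
  intros hu hcl [w [hw hlt]].
  rewrite (flow_unique _ _ _ _ _ _ _ hw hu _ period_2PI) in hlt. lra.
Qed.

Lemma returns_le_not_lt_closed b1 b2 a b x :
  returns_le b1 b2 a b x -> ~ returns_lt b1 b2 a b x ->
  exists u, flow b1 b2 a b x u /\ u (2 * PI) = x.
Proof.
  intros [u [hu hle]] hn. exists u. split; [exact hu | ].
  apply Rle_antisym; [exact hle | ]. apply Rnot_lt_le. intros hlt.
  apply hn. exists u. auto.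
Qed.

Lemma not_returns_le_open b1 b2 a b x :
  0 <= a -> 0 <= x -> ~ returns_le b1 b2 a b x ->
  exists d, 0 < d /\ forall a' b' x', 0 <= a' -> 0 <= x' ->
    Rabs (a' - a) <= d -> Rabs (b' - b) <= d -> Rabs (x' - x) <= d ->
    ~ returns_le b1 b2 a' b' x'.
Proof.
  intros ha hx hn. apply NNPP. intros hno. apply hn.
  apply returns_le_closed; auto. intros d hd. apply NNPP. intros hn2.
  apply hno. exists d. split; [exact hd | ].
  intros a' b' x' h1 h2 h3 h4 h5 h6. apply hn2. exists a', b', x'. auto 10.
Qed.

(** The estimate of singular_not_near_b_zero made uniform over a compact rectangle
    of initial values and values of a0. *)
Lemma no_singular_strip b1 b2 lo hi a1 :
  0 < lo -> 0 < b2 ->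
  exists d, 0 < d /\ forall a b x, 0 <= a <= a1 -> Rabs b <= d -> lo <= x <= hi ->
    ~ singular_v_neg b1 b2 a b x.
Proof.
  intros hlo hb2.
  destruct (compact_uniform (fun a d => forall x b, lo <= x <= hi -> Rabs b <= d ->
    ~ singular_v_neg b1 b2 a b x) 0 a1) as [d [hd hd']].
  - intros a d d' hdd hQ x b hx hb. apply hQ; [exact hx | lra].
  - intros a ha.
    destruct (compact_uniform (fun x d => forall a' b, 0 <= a' -> Rabs (a' - a) <= d ->
      Rabs b <= d -> ~ singular_v_neg b1 b2 a' b x) lo hi) as [d [hd hd']].
    + intros x d d' hdd hQ a' b ha' haa hb. apply hQ; auto; lra.
    + intros x hx.
      destruct (singular_not_near_b_zero b1 b2 a x) as [d [hd hd']]; try lra.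
      exists d. split; [exact hd | ]. intros y hy hyx a' b ha' haa hb.
      apply hd'; auto; lra.
    + exists d. split; [exact hd | ]. intros a' ha' haa x b hx hb.
      apply (hd' x hx); auto; lra.
  - exists d. split; [exact hd | ]. intros a b x ha hb hx. apply (hd' a ha); auto.
Qed.

(** For b0 slightly negative, let m be the supremum of the values of a0 for which
    the whole interval [lo, X] is displaced downwards.  At a0 = m there is a zero
    of the displacement at a local maximum: at X it would contradict
    large_closed_contracting, elsewhere it is a singular solution too close to
    b0 = 0. *)
Lemma b_zero_no_return b1 b2 eps a b x3 u :
  (forall a b x u G, 0 < a < eps -> - eps < b < 0 -> 0 < b + b2 -> 0 < x ->
     singular_data b1 b2 a b x u G -> forall t, period t -> v_along b1 b2 a b u t < 0) ->
  0 < a < eps -> - eps < b < 0 -> 0 < b + b2 -> 0 < x3 ->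
  flow b1 b2 a b x3 u -> u (2 * PI) = x3 ->
  forall x, 0 < x <= x3 -> ~ returns_le b1 b2 a 0 x.
Proof.
  intros Hv ha hb hB hx3 hu hcl lo hlo hret.
  assert (hx3n : forall c, b < c -> ~ returns_le b1 b2 a c x3).
  { intros c hc hle. apply (closed_not_returns_lt b1 b2 a b x3 u hu hcl).
    apply (returns_mono b1 b2 a c a b x3); auto; lra. }
  destruct (large_closed_contracting b1 b2 a b) as [X0 [hX0 hlarge]]; try lra.
  set (X := Rmax x3 X0).
  assert (hX1 : x3 <= X) by apply Rmax_l. assert (hX2 : X0 <= X) by apply Rmax_r.
  destruct (no_singular_strip b1 b2 lo X a) as [d [hd hnos]]; try lra.
  (* A value of b0 in (b, 0) that is close enough to 0 for no_singular_strip. *)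
  set (c := Rmax (b / 2) (- d)).
  assert (hc : b < c < 0 /\ Rabs c <= d).
  { unfold c, Rmax, Rabs; destruct Rle_dec; destruct Rcase_abs; lra. }
  destruct hc as [hc hcd].
  set (K := fun r => forall x, lo <= x <= X -> returns_lt b1 b2 r c x).
  assert (hKopen : forall r, K r -> exists e, 0 < e /\ forall s, Rabs (s - r) <= e -> K s).
  { intros r hr.
    destruct (compact_uniform (fun x e => forall s, Rabs (s - r) <= e -> returns_lt b1 b2 s c x)
      lo X) as [e [he he']].
    - intros x e e' hee hQ s hs. apply hQ. lra.
    - intros x hx. destruct (returns_lt_open b1 b2 r c x (hr x hx)) as [e [he he']].
      exists e. split; [exact he | ]. intros y hy hyx s hs. apply he'; [exact hs | | lra].
      rewrite Rminus_diag, Rabs_R0. lra.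
    - exists e. split; [exact he | ]. intros s hs x hx. apply (he' x hx s hs). }
  assert (hK0 : K 0).
  { intros x hx. apply a0_zero_returns_lt; lra. }
  assert (hKa : ~ K a).
  { intros h. apply (hx3n c); [lra | ]. apply returns_lt_le, h. lra. }
  assert (hKdown : forall r s, 0 <= s <= r -> K r -> K s).
  { intros r s hsr hr x hx. destruct (Req_dec s r) as [-> | hne]; [auto | ].
    apply (returns_mono b1 b2 r c s c x); try lra. apply returns_lt_le, hr, hx. }
  set (E := fun r => 0 <= r <= a /\ K r).
  destruct (completeness E) as [m [hm1 hm2]].
  { exists a. intros r [hr _]. lra. }
  { exists 0. split; [lra | exact hK0]. }
  assert (hma : m <= a) by (apply hm2; intros r [hr _]; lra).
  assert (hm0 : 0 < m).
  { destruct (hKopen 0 hK0) as [e [he he']].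
    assert (h : E (Rmin e a)).
    { split; [split; [apply Rmin_glb; lra | apply Rmin_r] | ].
      apply he'. rewrite Rminus_0_r, Rabs_right.
      - apply Rmin_l.
      - apply Rle_ge, Rmin_glb; lra. }
    apply hm1 in h. assert (0 < Rmin e a) by (apply Rmin_glb_lt; lra). lra. }
  assert (hKm : ~ K m).
  { intros h. destruct (hKopen m h) as [e [he he']].
    destruct (Req_dec m a) as [heq | hne]; [apply hKa; rewrite <- heq; exact h | ].
    assert (h' : E (Rmin (m + e) a)).
    { split; [split; [apply Rmin_glb; lra | apply Rmin_r] | ].
      apply he'. unfold Rmin, Rabs; destruct Rle_dec; destruct Rcase_abs; lra. }
    apply hm1 in h'. assert (m < Rmin (m + e) a) by (apply Rmin_glb_lt; lra). lra. }
  assert (hbelow : forall r, 0 <= r < m -> K r).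
  { intros r hr. apply NNPP. intros hn. assert (h : m <= r); [ | lra].
    apply hm2. intros s [hs hs']. apply Rnot_lt_le. intros hrs.
    apply hn, (hKdown s r); [lra | exact hs']. }
  assert (hle : forall x, lo <= x <= X -> returns_le b1 b2 m c x).
  { intros x hx. apply returns_le_closed; [lra | lra | ].
    intros e he. set (r := Rmax 0 (m - e)).
    assert (hr : 0 <= r < m /\ Rabs (r - m) <= e).
    { unfold r, Rmax, Rabs; destruct Rle_dec; destruct Rcase_abs; lra. }
    exists r, c, x. rewrite !Rminus_diag, Rabs_R0. splits; try lra.
    apply returns_lt_le, hbelow; [apply hr | exact hx]. }
  assert (hxh : exists x, lo <= x <= X /\ ~ returns_lt b1 b2 m c x).
  { apply NNPP. intros hn. apply hKm. intros x hx. apply NNPP. intros hn2.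
    apply hn. exists x. auto. }
  destruct hxh as [x [hx hnlt]].
  destruct (returns_le_not_lt_closed b1 b2 m c x (hle x hx) hnlt) as [w [hw hwcl]].
  assert (hxlo : lo < x).
  { destruct (Req_dec lo x) as [heq | hne]; [ | lra]. exfalso. apply hnlt.
    rewrite <- heq. apply (returns_mono b1 b2 a 0 m c lo); try lra. exact hret. }
  assert (hx0 : 0 < x) by lra.
  destruct (log_multiplier_exists m w (proj1 (proj1 hw))) as [G hG].
  destruct (curvature_exists m w G (proj1 (proj1 hw)) hG) as [H hH].
  destruct (returns_near_closed b1 b2 m c x w G H hx0 hw hwcl hG hH) as [e [he hnear]].
  assert (hside : forall y, lo <= y <= X -> y <> x -> Rabs (y - x) < e ->
    (0 < G (2 * PI) -> x < y -> False) /\ (G (2 * PI) < 0 -> y < x -> False)).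
  { intros y hy hyx hye. destruct (hnear y hyx hye) as [v [hv [k1 [k2 _]]]].
    destruct (hle y hy) as [v' [hv' hvle]].
    rewrite (flow_unique _ _ _ _ _ _ _ hv' hv _ period_2PI) in hvle.
    split; intros hGs hxy.
    - specialize (k1 hGs). nra.
    - specialize (k2 hGs). nra. }
  destruct (Rtotal_order (G (2 * PI)) 0) as [hGs | [hGs | hGs]].
  - set (y := Rmax lo (x - e / 2)).
    assert (hy : lo <= y < x /\ Rabs (y - x) < e).
    { unfold y, Rmax, Rabs; destruct Rle_dec; destruct Rcase_abs; lra. }
    apply (proj2 (hside y ltac:(lra) ltac:(lra) (proj2 hy)) hGs). lra.
  - assert (hsd : singular_data b1 b2 m c x w G) by (unfold singular_data; splits; auto).
    apply (hnos m c x); try lra. exists w, G. split; [exact hsd | ].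
    apply (Hv m c x w G); auto; lra.
  - destruct (Req_dec x X) as [heq | hne].
    + assert (h := hlarge m c x w G ltac:(lra) ltac:(lra) ltac:(lra) hw hwcl hG). lra.
    + set (y := Rmin X (x + e / 2)).
      assert (hy : x < y <= X /\ Rabs (y - x) < e).
      { unfold y, Rmin, Rabs; destruct Rle_dec; destruct Rcase_abs; lra. }
      apply (proj1 (hside y ltac:(lra) ltac:(lra) (proj2 hy)) hGs). lra.
Qed.

(** A multiplier different from 1 makes the displacement change sign, and a
    multiplier 1 gives a strict local maximum. *)
Lemma no_interior_minimum b1 b2 a b lo hi x u :
  (forall G, singular_data b1 b2 a b x u G -> forall t, period t -> v_along b1 b2 a b u t < 0) ->
  0 <= a -> 0 < b + b2 -> 0 < x -> lo < x < hi ->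
  flow b1 b2 a b x u -> u (2 * PI) = x ->
  (forall y, lo <= y <= hi -> ~ returns_lt b1 b2 a b y) -> False.
Proof.
  intros Hv ha hB hx hxx hu hcl hno.
  destruct (log_multiplier_exists a u (proj1 (proj1 hu))) as [G hG].
  destruct (curvature_exists a u G (proj1 (proj1 hu)) hG) as [H hH].
  destruct (returns_near_closed b1 b2 a b x u G H hx hu hcl hG hH) as [e [he hnear]].
  assert (hle : forall y w, lo <= y <= hi -> flow b1 b2 a b y w -> y <= w (2 * PI)).
  { intros y w hy hw. apply Rnot_lt_le. intros hlt. apply (hno y hy). exists w. auto. }
  set (l := Rmax lo (x - e / 2)).
  assert (hl : lo <= l < x /\ Rabs (l - x) < e).
  { unfold l, Rmax, Rabs; destruct Rle_dec; destruct Rcase_abs; lra. }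
  set (r := Rmin hi (x + e / 2)).
  assert (hr : x < r <= hi /\ Rabs (r - x) < e).
  { unfold r, Rmin, Rabs; destruct Rle_dec; destruct Rcase_abs; lra. }
  destruct (hnear l ltac:(lra) (proj2 hl)) as [wl [hwl [l1 [l2 l3]]]].
  destruct (hnear r ltac:(lra) (proj2 hr)) as [wr [hwr [r1 [r2 r3]]]].
  assert (hll := hle l wl ltac:(lra) hwl). assert (hrr := hle r wr ltac:(lra) hwr).
  destruct (Rtotal_order (G (2 * PI)) 0) as [hGs | [hGs | hGs]].
  - specialize (r2 hGs). nra.
  - assert (hsd : singular_data b1 b2 a b x u G) by (unfold singular_data; splits; auto).
    assert (hH1 : H (2 * PI) < 0).
    { apply (singular_curvature_neg b1 b2 a b x u G H); auto.
      intros t ht. left. apply (Hv G hsd t ht). }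
    specialize (l3 hGs hH1). lra.
  - specialize (l1 hGs). nra.
Qed.

(** The supremum m of the values of b0 for which some point of [x1, x3] is
    displaced downwards lies in [b, 0), and at b0 = m the displacement is
    nonnegative with an interior zero.  If there are no such values, x2 itself
    is that zero. *)
Lemma no_three_closed b1 b2 eps a b x1 x2 x3 u1 u2 u3 :
  (forall a b x u G, 0 < a < eps -> - eps < b < 0 -> 0 < b + b2 -> 0 < x ->
     singular_data b1 b2 a b x u G -> forall t, period t -> v_along b1 b2 a b u t < 0) ->
  0 < a < eps -> - eps < b < 0 -> 0 < b + b2 ->
  0 < x1 -> x1 < x2 -> x2 < x3 ->
  flow b1 b2 a b x1 u1 -> u1 (2 * PI) = x1 ->
  flow b1 b2 a b x2 u2 -> u2 (2 * PI) = x2 ->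
  flow b1 b2 a b x3 u3 -> u3 (2 * PI) = x3 -> False.
Proof.
  intros Hv ha hb hB hx1 h12 h23 hu1 hc1 hu2 hc2 hu3 hc3.
  assert (hzero := b_zero_no_return b1 b2 eps a b x3 u3 Hv ha hb hB ltac:(lra) hu3 hc3).
  set (K := fun c => forall x, x1 <= x <= x3 -> ~ returns_lt b1 b2 a c x).
  assert (hK0 : K 0).
  { intros x hx hlt. apply (hzero x ltac:(lra)). apply returns_lt_le, hlt. }
  destruct (classic (K b)) as [hKb | hKb].
  { apply (no_interior_minimum b1 b2 a b x1 x3 x2 u2); auto; try lra.
    intros G hG. apply (Hv a b x2 u2 G); auto; lra. }
  set (E := fun c => b <= c <= 0 /\ ~ K c).
  destruct (completeness E) as [m [hm1 hm2]].
  { exists 0. intros c [hc _]. lra. }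
  { exists b. split; [lra | exact hKb]. }
  assert (hmb : b <= m) by (apply hm1; split; [lra | exact hKb]).
  assert (hm0 : m <= 0) by (apply hm2; intros c [hc _]; lra).
  assert (hKm : K m).
  { intros x hx hlt. destruct (Req_dec m 0) as [heq | hne].
    { rewrite heq in hlt. exact (hK0 x hx hlt). }
    destruct (returns_lt_open b1 b2 a m x hlt) as [d [hd hd']].
    assert (h : E (Rmin (m + d) 0)).
    { split.
      - split; [apply Rmin_glb; lra | apply Rmin_r].
      - intros hk. apply (hk x hx). apply hd'; try (rewrite Rminus_diag, Rabs_R0; lra).
        unfold Rmin, Rabs; destruct Rle_dec; destruct Rcase_abs; lra. }
    apply hm1 in h. assert (m < Rmin (m + d) 0) by (apply Rmin_glb_lt; lra). lra. }
  assert (hbm : b < m).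
  { destruct (Req_dec b m) as [heq | hne]; [ | lra]. exfalso.
    apply hKb. rewrite heq. exact hKm. }
  assert (hex : exists x, x1 <= x <= x3 /\ returns_le b1 b2 a m x).
  { apply NNPP. intros hn.
    destruct (compact_uniform (fun x d => forall c, Rabs (c - m) <= d -> ~ returns_le b1 b2 a c x)
      x1 x3) as [d [hd hd']].
    - intros x d d' hdd hQ c hc. apply hQ. lra.
    - intros x hx. destruct (not_returns_le_open b1 b2 a m x) as [d [hd hd']]; try lra.
      { intros hle. apply hn. exists x. auto. }
      exists d. split; [exact hd | ]. intros y hy hyx c hc. apply hd'; try lra.
      rewrite Rminus_diag, Rabs_R0. lra.
    - assert (h : m <= m - d); [ | lra].
      apply hm2. intros c [hc hKc]. apply Rnot_lt_le. intros hlt.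
      assert (hcm : c <= m) by (apply hm1; split; assumption).
      apply hKc. intros x hx hret. apply (hd' x hx c).
      + unfold Rabs; destruct Rcase_abs; lra.
      + apply returns_lt_le, hret. }
  destruct hex as [x [hx hret]].
  assert (hmneg : m < 0).
  { destruct (Req_dec m 0) as [heq | hne]; [ | lra]. exfalso.
    rewrite heq in hret. apply (hzero x ltac:(lra) hret). }
  assert (hclosed_ne : forall y v, 0 < y -> flow b1 b2 a b y v -> v (2 * PI) = y -> x <> y).
  { intros y v hy hv hcl heq. apply (closed_not_returns_lt b1 b2 a b y v hv hcl).
    rewrite <- heq. apply (returns_mono b1 b2 a m a b x); auto; lra. }
  assert (hne1 := hclosed_ne x1 u1 hx1 hu1 hc1).
  assert (hne3 := hclosed_ne x3 u3 ltac:(lra) hu3 hc3).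
  destruct (returns_le_not_lt_closed b1 b2 a m x hret (hKm x hx)) as [w [hw hwcl]].
  apply (no_interior_minimum b1 b2 a m x1 x3 x w); auto; try lra.
  intros G hG. apply (Hv a m x w G); auto; lra.
Qed.

Lemma sign_neg_inv (r : R) : sign r = - 1 -> r < 0.
Proof. unfold sign. destruct total_order_T as [[h | h] | h]; lra. Qed.

Lemma conditions_v_neg b1 b2 a b x u G :
  conditions (coefA a) (coefB b b1 b2) -> 0 < b + b2 -> 0 < x ->
  singular_data b1 b2 a b x u G -> forall t, period t -> v_along b1 b2 a b u t < 0.
Proof.
  intros [tA [tB1 [tB2 [_ hcond]]]] hB hx [hu [hcl [hG hG1]]] t ht.
  destruct (hcond u (closed_singular b1 b2 a b x u G hx hu hcl hG hG1)) as [_ h3].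
  specialize (h3 t ht).
  assert (dA : forall s, Derive (coefA a) s = - cos s + a * sin s)
    by (intros s; apply is_derive_unique, coefA_derive).
  assert (dB : forall s, Derive (coefB b b1 b2) s = b1 * cos s - b2 * sin s)
    by (intros s; apply is_derive_unique, coefB_derive).
  rewrite (sign_eq_m1 (Derive (coefA a) 0 * coefB b b1 b2 0)) in h3.
  - apply sign_neg_inv in h3. unfold funv, funP in h3. rewrite dA, dB in h3.
    unfold v_along. lra.
  - rewrite dA. unfold coefB. rewrite sin_0, cos_0. nra.
Qed.

Lemma closed_flow b1 b2 a b u :
  positive_closed_solution (coefA a) (coefB b b1 b2) u ->
  exists w, flow b1 b2 a b (u 0) w /\ w (2 * PI) = u 0 /\ forall t, period t -> w t = u t.
Proof.
  intros [[hu hcl] _].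
  destruct (sol_of_abel (coefA a) (coefB b b1 b2) u) as [w [hw hwu]];
    auto using coefA_continuous, coefB_continuous.
  exists w. splits; auto.
  - split; [exact hw | apply hwu, period_0].
  - rewrite hwu by apply period_2PI. exact hcl.
Qed.

Theorem theorem5p5 (b1 b2 eps : R) (heps : 0 < eps)
  (H : forall a0 b0 : R, 0 < b0 + b2 ->
         - eps < b0 -> b0 < 0 -> 0 < a0 -> a0 < eps ->
         conditions (coefA a0) (coefB b0 b1 b2)) :
  forall a0 b0 : R, 0 < b0 + b2 ->
    - eps < b0 -> b0 < 0 -> 0 < a0 -> a0 < eps ->
    at_most_two_positive_closed_solutions (coefA a0) (coefB b0 b1 b2).
Proof.
  intros a0 b0 hB hb1 hb2 ha1 ha2 u1 u2 u3 h1 h2 h3.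
  assert (Hv : forall a b x u G, 0 < a < eps -> - eps < b < 0 -> 0 < b + b2 -> 0 < x ->
     singular_data b1 b2 a b x u G -> forall t, period t -> v_along b1 b2 a b u t < 0).
  { intros a b x u G ha hb hBb hx. apply conditions_v_neg; auto. apply H; lra. }
  assert (p1 := proj2 h1). assert (p2 := proj2 h2). assert (p3 := proj2 h3).
  destruct (closed_flow b1 b2 a0 b0 u1 h1) as [w1 [f1 [c1 e1]]].
  destruct (closed_flow b1 b2 a0 b0 u2 h2) as [w2 [f2 [c2 e2]]].
  destruct (closed_flow b1 b2 a0 b0 u3 h3) as [w3 [f3 [c3 e3]]].
  assert (hsame : forall u v w z, (forall t, period t -> w t = u t) ->
     (forall t, period t -> z t = v t) ->
     flow b1 b2 a0 b0 (u 0) w -> flow b1 b2 a0 b0 (v 0) z -> u 0 = v 0 -> same_solution u v).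
  { intros u v w z hw hz fw fz heq t ht. rewrite <- hw, <- hz by exact ht.
    rewrite <- heq in fz. exact (flow_unique _ _ _ _ _ _ _ fw fz t ht). }
  assert (hno : forall x y z wx wy wz, 0 < x -> x < y -> y < z ->
     flow b1 b2 a0 b0 x wx -> wx (2 * PI) = x -> flow b1 b2 a0 b0 y wy -> wy (2 * PI) = y ->
     flow b1 b2 a0 b0 z wz -> wz (2 * PI) = z -> False).
  { intros x y z wx wy wz hx hxy hyz. intros.
    apply (no_three_closed b1 b2 eps a0 b0 x y z wx wy wz); auto. }
  destruct (Req_dec (u1 0) (u2 0)) as [h12 | h12]; [left; eauto | ].
  destruct (Req_dec (u1 0) (u3 0)) as [h13 | h13]; [right; left; eauto | ].
  destruct (Req_dec (u2 0) (u3 0)) as [h23 | h23]; [right; right; eauto | ].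
  exfalso.
  destruct (Rlt_dec (u1 0) (u2 0)), (Rlt_dec (u1 0) (u3 0)), (Rlt_dec (u2 0) (u3 0)); try lra.
  - apply (hno (u1 0) (u2 0) (u3 0) w1 w2 w3); auto.
  - apply (hno (u1 0) (u3 0) (u2 0) w1 w3 w2); auto; lra.
  - apply (hno (u3 0) (u1 0) (u2 0) w3 w1 w2); auto; lra.
  - apply (hno (u2 0) (u1 0) (u3 0) w2 w1 w3); auto; lra.
  - apply (hno (u2 0) (u3 0) (u1 0) w2 w3 w1); auto; lra.
  - apply (hno (u3 0) (u2 0) (u1 0) w3 w2 w1); auto; lra.
Qed.
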